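(* Let $X$ be a Banach space and $f_k:X\to\mathbb{R}\cup\{+\infty\}$ $(k\in\mathbb{N}\cup\{0\})$ proper convex functions such that $C:=\operatorname{dom}f_0\cap\{x: f_k(x)\le0\ \forall k\in\mathbb{N}\}\neq\emptyset$. Let $\bar x\in X$ be a solution of problem (P): minimize $f_0(x)$ subject to $f_k(x)\le0$ $(k\in\mathbb{N})$. Suppose the Slater condition holds (there exists $x\in\operatorname{dom}f_0$ with $\sup_{k\in\mathbb{N}}f_k(x)<0$), and there exist $m\in\mathbb{N}\cup\{0\}$ and a solution $\lambda=(\lambda_1,\lambda_2,\ldots)\in\ell^\infty_+$ of problem (D$_m$) such that (i) the functions $f_0$, $\lambda_kf_k$ $(k=1,\ldots,m)$, $\lambda_kf_k^+$ $(k=m+1,m+2,\ldots)$ are lower semicontinuous on a neighbourhood of $\bar x$; (ii) the collection $\{f_0,\ \lambda_kf_k\ (k=1,\ldots,m),\ \lambda_kf_k^+\ (k=m+1,m+2,\ldots)\}$ is uniformly lower semicontinuous on a neighbourhood of $\bar x$. Then $\lambda_kf_k(\bar x)=0$ for $k=1,\ldots,m$, and for any $\varepsilon>0$ and $M>m$ there exist $n\in\mathbb{N}$ with $n>M$ and points $x_k\in B_\varepsilon(\bar x)$ $(k=0,\ldots,n)$ such that $$f_0(x_0)+\sum_{k=1}^m\lambda_kf_k(x_k)+\sum_{k=m+1}^n\lambda_kf_k^+(x_k)\le f_0(\bar x),$$ $$0\in\partial f_0(x_0)+\sum_{k=1}^m\lambda_k\partial f_k(x_k)+\sum_{k=m+1}^n\lambda_k\partial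 f_k^+(x_k)+\varepsilon\mathbb{B}^*,$$ with the convention $\lambda_k\partial f_k(x_k)=\lambda_k\partial f_k^+(x_k)=N_{\operatorname{dom}f_k}(x_k)$ when $\lambda_k=0$ $(k\in\mathbb{N})$.
   Context: Conventions: $0\cdot(+\infty)=+\infty$, $(+\infty)-(+\infty)=+\infty$. $f_k^+:=\max\{f_k,0\}$. $\ell^\infty_+$ is the set of nonnegative sequences in $\ell^\infty$. (D$_m$) is the problem $\sup_{\lambda\in\ell^\infty_+}\inf_{x\in X}\big(f_0(x)+\sum_{k=1}^m\lambda_kf_k(x)+\sum_{k=m+1}^\infty\lambda_kf_k^+(x)\big)$ (first sum zero if $m=0$); a solution attains the supremum. $B_\varepsilon(\bar x)$ is the open ball, $\mathbb{B}^*$ the open unit ball of $X^*$, $\partial$ the Fenchel subdifferential $\partial f(x)=\{x^*: f(y)-f(x)\ge\langle x^*,y-x\rangle\ \forall y\}$, $N_A(x)$ the normal cone of convex analysis. Uniform lower semicontinuity: for a nonempty index set $T$ and functions $g_t$ (here the listed collection), let $\mathcal{F}(T)$ be the finite subsets of $T$ directed by inclusion, $\limsup_{S\uparrow T}\alpha_S:=\inf_{S_0}\sup_{S\supset S_0}\alpha_S$, $\liminf_{S\uparrow T}\alpha_S:=\sup_{S_0}\inf_{S\supset S_0}\alpha_S$ over $S,S_0\in\mathcal{F}(T)$; $\big(\overline{\sum_{t\in T}}g_t\big)(x):=\limsup_{S\uparrow T}\sum_{t\in S}g_t(x)$; for $U\subset X$, $\Lambda_U(\{g_t\}):=\liminf_{S\uparrow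 T}\lim_{\delta\downarrow0}\inf\{\sum_{t\in S}g_t(x_t): x_t\in U,\ \operatorname{diam}\{x_t\}_{t\in S}<\delta\}$. The collection is uniformly lower semicontinuous on $U$ if $\inf_U\overline{\sum_{t\in T}}g_t\le\Lambda_U(\{g_t\})$. *)

(* Defs.v *)
From HB Require Import structures.
From mathcomp Require Import all_boot all_order all_algebra.
From mathcomp Require Import all_classical all_reals all_analysis.
Set Implicit Arguments. Unset Strict Implicit. Unset Printing Implicit Defensive.
Import Order.TTheory GRing.Theory Num.Theory.
Import numFieldNormedType.Exports.
Local Open Scope classical_set_scope.
Local Open Scope ring_scope.

Section Defs.
Context {R : realType} {X : normedModType R}.

(* scalar multiplication with the convention 0 * (+oo) = +oo *)
Definition esmul (l : R) (v : \bar R) : \bar R :=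
  match v with EPInf => +oo%E | _ => (l%:E * v)%E end.

Definition epos (f : X -> \bar R) : X -> \bar R := fun x => maxe (f x) 0%E.

Definition edom (f : X -> \bar R) : set X := [set x | (f x < +oo)%E].

Definition eproper (f : X -> \bar R) : Prop :=
  (forall x, f x != -oo%E) /\ (exists x, edom f x).

Definition econvex (f : X -> \bar R) : Prop :=
  forall (x y : X) (t : R), 0 < t < 1 ->
    (f (t *: x + (1 - t) *: y)%R <= t%:E * f x + (1 - t)%:E * f y)%E.

Definition dual_elt (l : X -> R) : Prop :=
  (forall x y, l (x + y) = l x + l y) /\
  (forall (a : R) x, l (a *: x) = a * l x) /\ continuous l.

Definition subdiff (f : X -> \bar R) (x : X) (l : X -> R) : Prop :=
  dual_elt l /\ f x \is a fin_num /\
  forall y, (f x + (l (y - x))%:E <= f y)%E.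

Definition ncone (A : set X) (x : X) (l : X -> R) : Prop :=
  dual_elt l /\ A x /\ forall y, A y -> l (y - x) <= 0.

(* lam * (subdifferential of f at x), with the convention that it is
   N_D(x) (D = dom f_k) when lam = 0 *)
Definition msubdiff (lam : R) (f : X -> \bar R) (D : set X) (x : X)
    (l : X -> R) : Prop :=
  if lam == 0 then ncone D x l
  else exists l', subdiff f x l' /\ l = (fun y => lam * l' y).

(* l belongs to eps * open unit ball of the dual, i.e. dual norm of l < eps *)
Definition dual_small (eps : R) (l : X -> R) : Prop :=
  exists c : R, c < eps /\ forall x, `|l x| <= c * `|x|.

Definition lsc_at (g : X -> \bar R) (x : X) : Prop :=
  forall a : R, (a%:E < g x)%E -> \forall y \near x, (a%:E < g y)%E.

Definition finsets : set (set nat) := [set S | finite_set S].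
Definition supsets (S0 : set nat) : set (set nat) :=
  [set S | finite_set S /\ S0 `<=` S].

(* (upper-bar sum_{t} g_t)(x) = limsup_{S up T} sum_{t in S} g_t(x), T = nat *)
Definition upper_sum (g : nat -> X -> \bar R) (x : X) : \bar R :=
  ereal_inf [set ereal_sup [set (\sum_(t \in S) g t x)%R | S in supsets S0]
            | S0 in finsets].

(* Lambda_U({g_t}); the monotone limit delta -> 0+ is written as the
   supremum over delta > 0; diam{x_t}_{t in S} < delta for finite S means
   all pairwise distances are < delta *)
Definition Lambda (g : nat -> X -> \bar R) (U : set X) : \bar R :=
  ereal_sup [set ereal_inf
    [set ereal_sup [set ereal_inf
        [set (\sum_(t \in S) g t (xs t))%R
        | xs in [set xs : nat -> X | (forall t, S t -> U (xs t)) /\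
                   (forall s t, S s -> S t -> `|xs s - xs t| < d)]]
      | d in [set d : R | 0 < d]]
    | S in supsets S0]
  | S0 in finsets].

Definition ulsc (g : nat -> X -> \bar R) (U : set X) : Prop :=
  (ereal_inf [set upper_sum g x | x in U] <= Lambda g U)%E.

Definition coll (m : nat) (lam : nat -> R) (f : nat -> X -> \bar R)
  : nat -> X -> \bar R :=
  fun t => if t == 0%N then f 0%N
           else if (t <= m)%N then (fun x => esmul (lam t) (f t x))
           else (fun x => esmul (lam t) (epos (f t) x)).

Definition pfeasible (f : nat -> X -> \bar R) (x : X) : Prop :=
  forall k, (0 < k)%N -> (f k x <= 0)%E.

Definition sol_P (f : nat -> X -> \bar R) (xb : X) : Prop :=
  pfeasible f xb /\ forall x, pfeasible f x -> (f 0%N xb <= f 0%N x)%E.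

Definition lagr (m : nat) (lam : nat -> R) (f : nat -> X -> \bar R) (x : X)
  : \bar R :=
  (f 0%N x + \sum_(1 <= k < m.+1) esmul (lam k) (f k x)
   + \sum_(m.+1 <= k <oo) esmul (lam k) (epos (f k) x))%E.

(* lam in l^infty_+ (indices k >= 1; lam 0 is unused) *)
Definition linf_pos (lam : nat -> R) : Prop :=
  (forall k, (0 < k)%N -> 0 <= lam k) /\
  exists B : R, forall k, (0 < k)%N -> lam k <= B.

Definition dval (m : nat) (f : nat -> X -> \bar R) (lam : nat -> R) : \bar R :=
  ereal_inf [set lagr m lam f x | x in setT].

Definition sol_D (m : nat) (f : nat -> X -> \bar R) (lam : nat -> R) : Prop :=
  linf_pos lam /\ dval m f lam = ereal_sup [set dval m f mu | mu in linf_pos].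

End Defs.

(* Main.v *)
(** Under the Slater condition there is no duality gap: the optimal value of (D_m)
    is that of (P), so the Lagrangian at [lam] is minimized over [X] at
    [xbar], with value [f_0 xbar]; complementary slackness follows, and the
    Lagrangian is the upper sum of the collection [g_t].  Uniform lower
    semicontinuity then makes [(xbar, ..., xbar)] an almost minimizer of the
    decoupled sum [g_0 x_0 + ... + g_n x_n] over nearly equal points, for some
    finite [n > M].  Adding a multiple of [\sum_t |x_t - x_0|] removes the
    constraint that the points be nearly equal, and Ekeland's principle for the
    max norm on [X^(n+1)] (whose slope does not depend on [n]) gives an exact
    minimizer of a perturbed sum.  The penalty and the perturbation are
    dominated by a seminorm, so Hahn-Banach yields subgradients of the [g_t];
    testing on constant families, where the penalty vanishes, bounds the norm of
    their sum.  *)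

Require Import Defs.
From HB Require Import structures.
From mathcomp Require Import all_boot all_order all_algebra.
From mathcomp Require Import all_classical all_reals all_analysis.
From mathcomp Require Import ring lra.
Set Implicit Arguments. Unset Strict Implicit. Unset Printing Implicit Defensive.
Import Order.TTheory GRing.Theory Num.Theory.
Import numFieldNormedType.Exports.
Local Open Scope classical_set_scope.
Local Open Scope ring_scope.

(** * Hahn-Banach separation by a seminorm *)

Section HahnBanach.
Context {R : realType} {V : lmodType R}.
Implicit Types (x y v w : V) (q : V -> R).

(** Homogeneity is asked only as an inequality, the form that an infimum yields directly; using it
    at [a^-1] restores equality. *)
Definition sublinear q : Prop :=
  (forall x y, q (x + y) <= q x + q y) /\
  (forall a x, 0 < a -> q (a *: x) <= a * q x).

Lemma sublinearZ q a x : sublinear q -> 0 < a -> q (a *: x) = a * q x.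
Proof.
move=> [_ qZ] a0; apply/eqP; rewrite eq_le qZ//=.
have := qZ a^-1 (a *: x); rewrite invr_gt0 scalerA mulVf ?gt_eqF// scale1r.
by move=> /(_ a0) h; rewrite -ler_pdivlMl.
Qed.

Lemma sublinear0 q : sublinear q -> q 0 = 0.
Proof. by move=> sq; have := sublinearZ 0 sq (ltr0Sn R 1); rewrite scaler0; lra. Qed.

Lemma sublinearN_ge q x : sublinear q -> - q (- x) <= q x.
Proof. by move=> sq; have := sq.1 x (- x); rewrite subrr (sublinear0 sq); lra. Qed.

Lemma le_inf_add (A B : set R) c : A !=set0 -> B !=set0 ->
  (forall a b, A a -> B b -> c <= a + b) -> c <= inf A + inf B.
Proof.
move=> A0 B0 cAB; rewrite -lerBlDr; apply: lb_le_inf => // a Aa.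
rewrite lerBlDl -lerBlDr; apply: lb_le_inf => // b Bb.
by rewrite lerBlDl; exact: cAB.
Qed.

Lemma le_inf_mul (A : set R) a c : 0 < a -> A !=set0 ->
  (forall b, A b -> c <= a * b) -> c <= a * inf A.
Proof.
move=> a0 A0 cA; rewrite -ler_pdivrMl//; apply: lb_le_inf => // b Ab.
by rewrite ler_pdivrMl//; exact: cA.
Qed.

(** Subadditivity survives the infimum because, of two members of a chain, the smaller one can serve
    for both arguments; the bound [- p (- x)] keeps the infimum finite. *)
Lemma chain_inf_sublinear p (A : set (V -> R)) : A !=set0 ->
  (forall q, A q -> sublinear q /\ forall x, q x <= p x) ->
  (forall q1 q2, A q1 -> A q2 ->
     (forall x, q1 x <= q2 x) \/ (forall x, q2 x <= q1 x)) ->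
  let r := fun x => inf [set q x | q in A] in
  sublinear r /\ forall q x, A q -> r x <= q x.
Proof.
move=> [q0 Aq0] Asub Atot r.
have lbr x : has_lbound [set q x | q in A].
  exists (- p (- x)) => _ [q Aq <-]; have [sq qp] := Asub _ Aq.
  by apply: le_trans (sublinearN_ge x sq); rewrite lerN2.
have ne x : [set q x | q in A] !=set0 by exists (q0 x); exists q0.
have rle q x : A q -> r x <= q x by move=> Aq; apply: ge_inf => //; exists q.
split=> //; split=> [x y|a x a0].
- apply: le_inf_add => // _ _ [q1 Aq1 <-] [q2 Aq2 <-].
  have [q12|q21] := Atot _ _ Aq1 Aq2.
  + apply: (le_trans (rle _ _ Aq1)); apply: (le_trans ((Asub _ Aq1).1.1 x y)).
    by rewrite lerD2l.
  + apply: (le_trans (rle _ _ Aq2)); apply: (le_trans ((Asub _ Aq2).1.1 x y)).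
    by rewrite lerD2r.
- apply: le_inf_mul => // _ [q Aq <-].
  by apply: (le_trans (rle _ _ Aq)); exact: (Asub _ Aq).1.2.
Qed.

Lemma minimal_sublinear p : sublinear p -> exists q, [/\ sublinear q,
  forall x, q x <= p x &
  forall q', sublinear q' -> (forall x, q' x <= q x) -> q' = q].
Proof.
move=> sp.
pose T := {q | sublinear q /\ forall x, q x <= p x}.
(* The order is reversed, so that Zorn's maximal element is a minimal functional. *)
pose Rel (s t : T) := `[< forall x, sval t x <= sval s x >].
have [| | | |[q [sq qp]] qmin] := @Zorn T Rel.
- by move=> t; apply/asboolP.
- move=> r s t /asboolP rs /asboolP st; apply/asboolP => x.
  exact: le_trans (st x) (rs x).
- move=> [s hs] [t ht] /asboolP/= st /asboolP/= ts; apply: eq_exist.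
  by apply/funext => x; apply/eqP; rewrite eq_le st ts.
- move=> A Atot; have [A0|/set0P[q0 Aq0]] := eqVneq A set0.
    (* The empty chain is bounded by [p] itself. *)
    by exists (exist (fun q => sublinear q /\ forall x, q x <= p x) p
      (conj sp (fun=> lexx _))) => s; rewrite A0.
  have := @chain_inf_sublinear p [set sval t | t in A].
  case.
  + by exists (sval q0); exists q0.
  + by move=> _ [[q hq] _ <-].
  + move=> _ _ [q1 Aq1 <-] [q2 Aq2 <-].
    by have [/asboolP|/asboolP] := Atot _ _ Aq1 Aq2; [right|left].
  move=> sr rle.
  have rp x : inf [set q x | q in [set sval t | t in A]] <= p x.
    by apply: (le_trans (rle (sval q0) x _)); [exists q0|exact: (proj2_sig q0).2].
  exists (exist (fun q => sublinear q /\ forall x, q x <= p x) _ (conj sr rp)).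
  move=> s As; apply/asboolP => x /=.
  by apply: rle; exists s.
exists q; split=> // q' sq' q'q.
have q'p x : q' x <= p x by exact: le_trans (qp x).
have := qmin (exist (fun q => sublinear q /\ forall x, q x <= p x) q'
  (conj sq' q'p)) ltac:(by apply/asboolP).
by move=> /(congr1 sval).
Qed.

(* For a minimal [q], the sublinear functional
   [x |-> inf_{t >= 0} (q (x + t y) - t q y)] lies below [q], hence equals it;
   at [x = - y] and [t = 1] this gives [q (- y) <= - q y]. *)
Lemma minimal_sublinear_opp q y : sublinear q ->
  (forall q', sublinear q' -> (forall x, q' x <= q x) -> q' = q) ->
  q (- y) <= - q y.
Proof.
move=> sq qmin.
pose E x := [set q (x + t *: y) - t * q y | t in [set t | 0 <= t]].
have tq t : 0 <= t -> q (t *: y) = t * q y.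
  rewrite le_eqVlt => /orP[/eqP<-|t0]; last by rewrite sublinearZ.
  by rewrite scale0r mul0r sublinear0.
have lbE x : has_lbound (E x).
  exists (- q (- x)) => _ [t /= t0 <-].
  have := sq.1 (x + t *: y) (- x); rewrite addrAC subrr add0r tq//; lra.
have neE x : E x !=set0 by exists (q (x + 0 *: y) - 0 * q y); exists 0 => /=.
have Ele x t : 0 <= t -> inf (E x) <= q (x + t *: y) - t * q y.
  by move=> t0; apply: ge_inf => //; exists t.
have sE : sublinear (fun x => inf (E x)).
  split=> [u v|a u a0].
  - apply: le_inf_add => // _ _ [s /= s0 <-] [t /= t0 <-].
    apply: (le_trans (Ele _ (s + t) (addr_ge0 s0 t0))).
    have := sq.1 (u + s *: y) (v + t *: y).
    by rewrite scalerDl (addrACA u); lra.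
  - apply: le_inf_mul => // _ [s /= s0 <-].
    apply: (le_trans (Ele _ (a * s) (mulr_ge0 (ltW a0) s0))).
    by rewrite -scalerA -scalerDr sublinearZ//; lra.
have := qmin _ sE _ => <-; last first.
  by move=> x; have := Ele x 0 (lexx _); rewrite scale0r addr0 mul0r subr0.
have := Ele (- y) 1 ler01; rewrite scale1r addNr sublinear0// mul1r sub0r.
move=> /le_trans; apply; rewrite lerN2.
by have := Ele y 0 (lexx _); rewrite scale0r addr0 mul0r subr0.
Qed.

(** A minimal sublinear functional below [p] is odd, and an odd sublinear functional is linear. *)
Lemma hahn_banach p : sublinear p -> exists N : V -> R,
  [/\ forall x y, N (x + y) = N x + N y, forall a x, N (a *: x) = a * N x &
      forall x, N x <= p x].
Proof.
move=> /minimal_sublinear[q [sq qp qmin]]; exists q.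
have qN x : q (- x) = - q x.
  apply/eqP; rewrite eq_le minimal_sublinear_opp//=.
  by rewrite lerNl; exact: sublinearN_ge.
split=> // [x y|a x].
- apply/eqP; rewrite eq_le sq.1/= .
  by have := sq.1 (- x) (- y); rewrite -opprD !qN; lra.
- have [a0|a0|->] := ltrgt0P a; first by rewrite sublinearZ.
  + have := @sublinearZ q (- a) x sq; rewrite oppr_gt0 scaleNr qN => /(_ a0); lra.
  + by rewrite scale0r mul0r sublinear0.
Qed.

(* Hahn-Banach applied to
   [q v = inf_{t > 0, w in D} (S (t v + w) + h w) / t]: [w = 0] gives
   [q <= S], and [v = - w, t = 1] gives [q (- w) <= h w]. *)
Lemma seminorm_sandwich (S h : V -> R) (D : set V) :
  (forall x y, S (x + y) <= S x + S y) ->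
  (forall a x, S (a *: x) = `|a| * S x) ->
  D 0 -> h 0 = 0 ->
  (forall x y t, D x -> D y -> 0 < t < 1 ->
     D (t *: x + (1 - t) *: y) /\
     h (t *: x + (1 - t) *: y) <= t * h x + (1 - t) * h y) ->
  (forall x, D x -> 0 <= h x + S x) ->
  exists N : V -> R, [/\ forall x y, N (x + y) = N x + N y,
    forall a x, N (a *: x) = a * N x,
    forall x, `|N x| <= S x & forall x, D x -> N x <= h x].
Proof.
move=> SD SZ D0 h0 hconv hS.
have SN x : S (- x) = S x by rewrite -scaleN1r SZ normrN1 mul1r.
pose E v := [set (S (p.1 *: v + p.2) + h p.2) / p.1 |
             p in [set p : R * V | 0 < p.1 /\ D p.2]].
have lbE v : has_lbound (E v).
  exists (- S v) => _ [[t w] [/= t0 Dw] <-].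
  rewrite ler_pdivlMr//; have := hS _ Dw.
  have := SD (t *: v + w) (- (t *: v)); rewrite addrAC subrr add0r SN SZ gtr0_norm//.
  lra.
have neE v : E v !=set0.
  by exists ((S (1 *: v + 0) + h 0) / 1); exists (1, 0) => //=; split.
have Ele v t w : 0 < t -> D w -> inf (E v) <= (S (t *: v + w) + h w) / t.
  by move=> t0 Dw; apply: ge_inf => //; exists (t, w).
have sE : sublinear (fun v => inf (E v)).
  split=> [u v|a u a0].
  - apply: le_inf_add => // _ _ [[s x] [/= s0 Dx] <-] [[t y] [/= t0 Dy] <-].
    have st0 : 0 < s + t by lra.
    (* With these weights [u] and [v] receive the same coefficient [s * t / (s + t)], so the
       combined point is admissible for [u + v]. *)
    have k01 : 0 < t / (s + t) < 1.
      by rewrite divr_gt0//= ltr_pdivrMr//; lra.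
    have [Dw hw] := hconv _ _ _ Dx Dy k01.
    have k1 : 1 - t / (s + t) = s / (s + t) by field; rewrite gt_eqF.
    rewrite k1 in Dw hw.
    have tau0 : 0 < s * t / (s + t) by rewrite divr_gt0// mulr_gt0.
    apply: (le_trans (Ele _ _ _ tau0 Dw)).
    set w := _ + _ *: y in Dw hw *.
    have -> : (s * t / (s + t)) *: (u + v) + w =
        (t / (s + t)) *: (s *: u + x) + (s / (s + t)) *: (t *: v + y).
      rewrite !scalerDr !scalerA /w addrACA; congr (_ + _ + (_ + _)).
        by congr (_ *: u); field; rewrite gt_eqF.
      by congr (_ *: v); field; rewrite gt_eqF.
    have := SD ((t / (s + t)) *: (s *: u + x)) ((s / (s + t)) *: (t *: v + y)).
    rewrite !SZ !gtr0_norm ?divr_gt0// => Sle.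
    rewrite ler_pdivrMr//.
    apply: (le_trans (lerD Sle hw)).
    rewrite le_eqVlt; apply/orP; left; apply/eqP.
    by field; rewrite !gt_eqF.
  - apply: le_inf_mul => // _ [[s x] [/= s0 Dx] <-].
    have sa0 : 0 < s / a by rewrite divr_gt0.
    apply: (le_trans (Ele _ _ _ sa0 Dx)).
    rewrite scalerA divfK ?gt_eqF// le_eqVlt; apply/orP; left; apply/eqP.
    by field; rewrite !gt_eqF.
have [N [ND NZ NE]] := hahn_banach sE.
have NS x : N x <= S x.
  apply: (le_trans (NE x)); have := Ele x 1 0 ltr01 D0.
  by rewrite scale1r addr0 h0 addr0 divr1.
have NN x : N (- x) = - N x by rewrite -scaleN1r NZ mulN1r.
(* The bound coming from [h] concerns [N (- x)], hence the change of sign. *)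
exists (fun x => - N x); split=> [x y|a x|x|x Dx].
- by rewrite ND opprD.
- by rewrite NZ mulrN.
- by rewrite normrN ler_norml NS andbT lerNl -NN -SN NS.
- rewrite -NN; apply: (le_trans (NE _)).
  have := Ele (- x) 1 x ltr01 Dx.
  have S0 : S 0 = 0 by rewrite -(scale0r 0) SZ normr0 mul0r.
  by rewrite scale1r addNr S0 add0r divr1.
Qed.

End HahnBanach.

(** * Ekeland's principle and Lagrange multipliers *)

Section Ekeland.
Context {R : realType} {T : Type}.
Variables (d : T -> T -> R) (A : set T) (phi : T -> R) (c b : R).
Hypothesis dxx : forall x, d x x = 0.
Hypothesis dC : forall x y, d x y = d y x.
Hypothesis d_triangle : forall x y z, d x z <= d x y + d y z.
Hypothesis c0 : 0 < c.
Hypothesis phi_ge : forall x, A x -> b <= phi x.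
(** Completeness of the space and lower semicontinuity of [phi] in one condition, asked only along
    Cauchy sequences with decreasing values. *)
Hypothesis phi_complete : forall u : nat -> T, (forall n, A (u n)) ->
  (forall e, 0 < e ->
     exists N, forall i j, (N <= i)%N -> (N <= j)%N -> d (u i) (u j) <= e) ->
  (forall n, phi (u n.+1) <= phi (u n)) ->
  exists l, [/\ A l,
    forall e, 0 < e -> exists N, forall i, (N <= i)%N -> d (u i) l <= e &
    forall n, phi l <= phi (u n)].

(** Ekeland's preorder: [P x] collects the points whose gain in [phi] pays for their distance from
    [x]. *)
Let P x := [set y | A y /\ phi y + c * d x y <= phi x].

Let d_ge0 x y : 0 <= d x y.
Proof. by have := d_triangle x y x; rewrite dxx (dC y x); lra. Qed.

Let Pxx x : A x -> P x x.
Proof. by split=> //; rewrite dxx mulr0 addr0. Qed.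

Let P_trans x y z : P x y -> P y z -> P x z.
Proof.
move=> [Ay xy] [Az yz]; split=> //.
have := ler_wpM2l (ltW c0) (d_triangle x y z); rewrite mulrDr; lra.
Qed.

Let P_near_inf (nx : nat * T) : exists y, A nx.2 ->
  P nx.2 y /\ forall z, P nx.2 z -> phi y <= phi z + nx.1.+1%:R^-1.
Proof.
case: nx => n x /=; have [Ax|] := pselect (A x); last by exists x.
have hinf : has_inf [set phi z | z in P x].
  split; first by exists (phi x); exists x => //; exact: Pxx.
  by exists b => _ [z [Az _] <-]; exact: phi_ge.
have n0 : 0 < n.+1%:R^-1 :> R by rewrite invr_gt0.
have [_ [y Py <-] yP] := inf_adherent n0 hinf.
exists y => _; split=> // z Pz; apply: (le_trans (ltW yP)); rewrite lerD2r.
by apply: ge_inf; [exact: hinf.2|exists z].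
Qed.

(** Each [u n.+1] nearly minimizes [phi] over [P (u n)]. Distances are paid for by the decrease of
    [phi], so the sequence is Cauchy, and its limit [l] lies in every [P (u n)]. *)
Lemma ekeland x0 : A x0 -> exists l, [/\ A l,
  phi l + c * d x0 l <= phi x0 & forall x, A x -> phi l <= phi x + c * d l x].
Proof.
move=> Ax0; have [step stepP] := choice P_near_inf.
pose u := fix u n := if n is k.+1 then step (k, u k) else x0.
have uA n : A (u n).
  by elim: n => [//|n IH] /=; exact: (stepP (n, u n) IH).1.1.
have uP i j : (i <= j)%N -> P (u i) (u j).
  move=> /subnK<-; elim: (j - i)%N => [|k IH]; first exact: Pxx.
  by apply: (P_trans IH); exact: (stepP (_, _) (uA _)).1.
have uinf n z : P (u n) z -> phi (u n.+1) <= phi z + n.+1%:R^-1.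
  exact: (stepP (n, u n) (uA n)).2.
have u_dec i j : (i <= j)%N -> phi (u j) <= phi (u i).
  by move=> /uP[_]; have := mulr_ge0 (ltW c0) (d_ge0 (u i) (u j)); lra.
have hinf : has_inf [set phi (u n) | n in setT].
  split; first by exists (phi (u 0%N)); exists 0%N.
  by exists b => _ [n _ <-]; exact: phi_ge.
have [e e0|n|l [Al lu phil]] := phi_complete uA.
- have ce0 : 0 < c * e by rewrite mulr_gt0.
  have [_ [N _ <-] uN] := inf_adherent ce0 hinf.
  exists N => i j; wlog ij : i j / (i <= j)%N => [hw Ni Nj|Ni Nj].
    by have [/hw|/ltnW/hw] := leqP i j; [exact|rewrite dC; exact].
  have [_ uij] := uP _ _ ij.
  have uiN := u_dec _ _ Ni.
  have ujI : inf [set phi (u n) | n in setT] <= phi (u j).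
    by apply: ge_inf; [exact: hinf.2|exists j].
  by rewrite -(ler_pM2l c0); lra.
- exact: u_dec.
have lP n : P (u n) l.
  split=> //; apply/ler_addgt0Pr => e e0.
  have ec0 : 0 < e / c by rewrite divr_gt0.
  have [N /(_ (maxn N n) (leq_maxl _ _)) uNl] := lu _ ec0.
  have [_ un] := uP _ _ (leq_maxr N n).
  have := ler_wpM2l (ltW c0) (d_triangle (u n) (u (maxn N n)) l).
  rewrite mulrDr; have := phil (maxn N n).
  have : c * d (u (maxn N n)) l <= e by rewrite -ler_pdivlMl// mulrC.
  lra.
exists l; split=> //; first exact: (lP 0%N).2.
move=> x Ax; rewrite leNgt; apply/negP => xl.
have Plx : P l x by split=> //; exact: ltW.
have : phi x < phi l by have := mulr_ge0 (ltW c0) (d_ge0 l x); lra.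
(* A point [x] improving on [l] would lie in every [P (u k)], where [u k.+1] is optimal up to
   [1 / (k + 1)]. *)
move=> /ltr_add_invr[k]; apply/negP; rewrite -leNgt.
apply: (le_trans (phil k.+1)); apply: uinf.
exact: P_trans (lP k) Plx.
Qed.

End Ekeland.

Section Lagrange.
Context {R : realType} {V : lmodType R}.
Implicit Types (A : set V) (phi : V -> R).

Definition cvx_set A : Prop := forall x y t, A x -> A y -> 0 < t < 1 ->
  A (t *: x + (1 - t) *: y).

Definition cvx_on A phi : Prop := forall x y (t : R), A x -> A y -> 0 < t < 1 ->
  phi (t *: x + (1 - t) *: y) <= t * phi x + (1 - t) * phi y.

Lemma cvx_onW A A' phi : A' `<=` A -> cvx_on A phi -> cvx_on A' phi.
Proof. by move=> A'A cphi x y t /A'A Ax /A'A Ay; exact: cphi. Qed.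

Lemma cvx_onD A phi psi : cvx_on A phi -> cvx_on A psi ->
  cvx_on A (fun x => phi x + psi x).
Proof.
move=> cphi cpsi x y t Ax Ay t01.
have := cphi _ _ _ Ax Ay t01; have := cpsi _ _ _ Ax Ay t01; lra.
Qed.

Lemma cvx_onZ A phi a : 0 <= a -> cvx_on A phi -> cvx_on A (fun x => a * phi x).
Proof.
move=> a0 cphi x y t Ax Ay t01.
have := ler_wpM2l a0 (cphi _ _ _ Ax Ay t01); lra.
Qed.

Lemma cvx_on_sum A n (phi : nat -> V -> R) :
  (forall i, (i < n)%N -> cvx_on A (phi i)) ->
  cvx_on A (fun x => \sum_(i < n) phi i x).
Proof.
elim: n => [|n IH] cphi.
  by move=> x y t _ _ _; rewrite !big_ord0 !mulr0 addr0.
have -> : (fun x => \sum_(i < n.+1) phi i x) =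
          (fun x => \sum_(i < n) phi i x + phi n x).
  by apply/funext => x; rewrite big_ord_recr.
apply: cvx_onD; last exact: cphi.
by apply: IH => i /ltnW; exact: cphi.
Qed.

(* The admissible multipliers form the interval between the supremum of
   [(v - phi x) / g x] over [g x > 0] and the infimum of
   [(phi y - v) / - g y] over [g y < 0]; evaluating [phi] at the point of
   [[x, y]] where the interpolated [g] vanishes shows it is nonempty. *)
Lemma lagrange_one A phi g x0 v : cvx_set A -> cvx_on A phi -> cvx_on A g ->
  A x0 -> g x0 < 0 -> (forall x, A x -> g x <= 0 -> v <= phi x) ->
  exists2 r, 0 <= r & forall x, A x -> v <= phi x + r * g x.
Proof.
move=> cA cphi cg Ax0 gx0 hv.
pose E := [set (phi y - v) / - g y | y in [set y | A y /\ g y < 0]].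
have E0 : E !=set0 by exists ((phi x0 - v) / - g x0); exists x0.
have lbE : lbound E 0.
  move=> _ [y [Ay gy] <-]; have := hv _ Ay (ltW gy).
  by move=> ?; rewrite divr_ge0//; lra.
exists (inf E); first exact: lb_le_inf.
move=> x Ax; have [gx|gx|gx] := ltrgt0P (g x); last first.
- by rewrite gx mulr0 addr0; apply: hv => //; rewrite gx.
- have : inf E <= (phi x - v) / - g x.
    by apply: ge_inf; [exists 0|exists x].
  by rewrite ler_pdivlMr ?oppr_gt0//; lra.
- suff : (v - phi x) / g x <= inf E by rewrite ler_pdivrMr//; lra.
  apply: lb_le_inf => // _ [y [Ay gy] <-].
  have gxy : 0 < g x - g y by lra.
  have t01 : 0 < g x / (g x - g y) < 1.
    by rewrite divr_gt0//= ltr_pdivrMr//; lra.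
  have t1 : 1 - g x / (g x - g y) = - g y / (g x - g y).
    by field; rewrite gt_eqF.
  have gz := cg _ _ _ Ay Ax t01.
  have gz0 : g x / (g x - g y) * g y + (1 - g x / (g x - g y)) * g x = 0.
    by rewrite t1; field; rewrite gt_eqF.
  rewrite gz0 in gz.
  have := le_trans (hv _ (cA _ _ _ Ay Ax t01) gz) (cphi _ _ _ Ay Ax t01).
  rewrite t1 mulrAC (mulrAC (- g y)) -mulrDl ler_pdivlMr// => h.
  rewrite ler_pdivrMr// mulrAC ler_pdivlMr ?oppr_gt0//; lra.
Qed.

(** Induction on the number of constraints: the last one is first absorbed into the convex domain,
    then recovered by [lagrange_one] applied to the Lagrangian of the others. *)
Lemma lagrange_multipliers n A phi (g : nat -> V -> R) x0 v :
  cvx_set A -> cvx_on A phi -> (forall i, (i < n)%N -> cvx_on A (g i)) ->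
  A x0 -> (forall i, (i < n)%N -> g i x0 < 0) ->
  (forall x, A x -> (forall i, (i < n)%N -> g i x <= 0) -> v <= phi x) ->
  exists2 mu : nat -> R, forall i, 0 <= mu i &
    forall x, A x -> v <= phi x + \sum_(i < n) mu i * g i x.
Proof.
elim: n A => [|n IH] A cA cphi cg Ax0 gx0 hv.
  by exists (fun=> 0) => // x Ax; rewrite big_ord0 addr0; exact: hv.
pose A' := [set x | A x /\ g n x <= 0].
have cgn : cvx_on A (g n) by exact: cg.
have A'A : A' `<=` A by move=> x [].
have [|||||x [Ax gnx] gx|mu mu0 hmu] := IH A'.
- move=> x y t [Ax gx] [Ay gy] t01; split; first exact: cA.
  have /andP[t0 t1] := t01.
  apply: (le_trans (cgn _ _ _ Ax Ay t01)).
  by rewrite -[leRHS]addr0 lerD// mulr_ge0_le0//; lra.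
- exact: cvx_onW cphi.
- by move=> i /ltnW/cg; exact: cvx_onW.
- by split=> //; rewrite ltW// gx0.
- by move=> i /ltnW; exact: gx0.
- apply: hv => // i; rewrite ltnS leq_eqVlt => /orP[/eqP->//|]; exact: gx.
have [| |x Ax gnx|r r0 hr] := @lagrange_one A
    (fun x => phi x + \sum_(i < n) mu i * g i x) (g n) x0 v cA _ cgn Ax0.
- apply: cvx_onD => //; apply: (@cvx_on_sum _ _ (fun i x => mu i * g i x)) => i ni.
  by apply: cvx_onZ => //; apply: cg; exact: ltnW.
- exact: gx0.
- exact: hmu.
exists (fun i => if (i < n)%N then mu i else r) => [i|x Ax].
  by case: ifP.
rewrite big_ord_recr/= ltnn addrA.
by under eq_bigr => i _ do rewrite ltn_ord; exact: hr.
Qed.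

End Lagrange.

(** * Decoupled sums *)

Section FiniteFamilies.
Context {R : realType} {X : normedModType R}.
Variable n : nat.
Implicit Types x y w : nat -> X.

(** Families remain functions on [nat], so this is only a seminorm: entries beyond [n] are invisible
    to it. *)
Definition maxnorm w : R := \big[Num.max/0]_(t < n.+1) `|w t|.

Definition spread w : R := \sum_(t < n.+1) `|w t - w 0%N|.

Lemma maxnorm_ge0 w : 0 <= maxnorm w.
Proof. exact: bigmax_ge_id. Qed.

Lemma le_maxnorm w t : (t < n.+1)%N -> `|w t| <= maxnorm w.
Proof.
by move=> tn; apply: (le_bigmax _ (fun t : 'I_n.+1 => `|w t|) (Ordinal tn)).
Qed.

Lemma maxnorm_le w a : 0 <= a -> (forall t, (t < n.+1)%N -> `|w t| <= a) ->
  maxnorm w <= a.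
Proof. by move=> a0 wa; apply: bigmax_le => // t _; exact: wa. Qed.

Lemma maxnormD x y : maxnorm (x + y) <= maxnorm x + maxnorm y.
Proof.
apply: maxnorm_le => [|t tn]; first by rewrite addr_ge0// maxnorm_ge0.
by apply: (le_trans (ler_normD _ _)); rewrite lerD// le_maxnorm.
Qed.

Lemma maxnormN w : maxnorm (- w) = maxnorm w.
Proof. by apply: eq_bigr => t _; rewrite !fctE normrN. Qed.

Lemma maxnormZ a w : maxnorm (a *: w) = `|a| * maxnorm w.
Proof.
have le b v : maxnorm (b *: v) <= `|b| * maxnorm v.
  apply: maxnorm_le => [|t tn]; first by rewrite mulr_ge0// maxnorm_ge0.
  by rewrite !fctE normrZ ler_wpM2l// le_maxnorm.
apply/eqP; rewrite eq_le le/=.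
have [->|a0] := eqVneq a 0; first by rewrite normr0 mul0r maxnorm_ge0.
have := le a^-1 (a *: w); rewrite scalerA mulVf// scale1r normfV.
by rewrite ler_pdivlMl// normr_gt0.
Qed.

Lemma spread_ge0 w : 0 <= spread w.
Proof. by apply: sumr_ge0. Qed.

Lemma spreadD x y : spread (x + y) <= spread x + spread y.
Proof.
rewrite /spread -big_split/=; apply: ler_sum => t _; rewrite !fctE.
by rewrite opprD addrACA ler_normD.
Qed.

Lemma spreadZ a w : spread (a *: w) = `|a| * spread w.
Proof.
rewrite /spread mulr_sumr; apply: eq_bigr => t _.
by rewrite !fctE -scalerBr normrZ.
Qed.

Lemma spread_cst (a : X) w : (forall t, (t < n.+1)%N -> w t = a) -> spread w = 0.
Proof. by move=> wa; apply: big1 => t _; rewrite !wa// subrr normr0. Qed.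

Lemma le_spread w t : (t < n.+1)%N -> `|w t - w 0%N| <= spread w.
Proof.
move=> tn; rewrite /spread (bigD1 (Ordinal tn))//= lerDl; exact: sumr_ge0.
Qed.

(** The factor depends on [n], which is harmless: it serves limits and the continuity of single
    functionals, never the final norm bound. *)
Lemma spread_le_maxnorm w : spread w <= n.+1%:R * (maxnorm w *+ 2).
Proof.
rewrite -[n.+1 in leRHS]card_ord mulr_natl -sumr_const; apply: ler_sum => t _.
by apply: (le_trans (ler_normB _ _)); rewrite mulr2n lerD// le_maxnorm.
Qed.

End FiniteFamilies.

(** * Real-valued convex functions on a domain, and bounded functionals *)

Section RealConvexAnalysis.
Context {R : realType} {X : normedModType R}.

(* Lower semicontinuity at [x] of the function equal to [r] on [D] and to
   [+oo] elsewhere. *)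
Definition lsc_on_at (D : set X) (r : X -> R) (x : X) : Prop :=
  forall a, (D x -> a < r x) -> \forall y \near x, D y -> a < r y.

(** Contracting the ball towards [x0] brings it into a neighbourhood where [r] exceeds [r x0 - 1];
    convexity carries this bound back to the whole ball. *)
Lemma cvx_lsc_lower_bound (D : set X) (r : X -> R) (x0 : X) (rho : R) :
  cvx_on D r -> cvx_set D -> D x0 -> lsc_on_at D r x0 ->
  exists b, forall x, D x -> `|x - x0| <= rho -> b <= r x.
Proof.
move=> cr cD Dx0 /(_ (r x0 - 1)) lr.
have /nbhs_ballP[e /= e0 er] := lr ltac:(by move=> _; lra).
pose q := `|rho| + e.
have q0 : 0 < q by rewrite ltr_wpDl.
(* Here [s * q = e / 2], so contracted points stay within [e] of [x0]; the summand [e] in [q]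
   ensures [q > 0] and [s < 1]. *)
pose s := e / (2 * q).
have s0 : 0 < s by rewrite divr_gt0//; lra.
have sq : s * q < e by rewrite /s invfM mulrA mulfVK ?gt_eqF//; lra.
have s1 : s < 1 by rewrite -(ltr_pM2r q0) mul1r (lt_le_trans sq)// lerDr.
exists (r x0 - s^-1) => x Dx xrho.
have s01 : 0 < s < 1 by rewrite s0.
have := cr _ _ _ Dx Dx0 s01.
have zx0 : x0 - (s *: x + (1 - s) *: x0) = - (s *: (x - x0)).
  have -> : s *: x + (1 - s) *: x0 = s *: (x - x0) + x0.
    by rewrite scalerBl scale1r scalerBr addrA addrAC.
  by rewrite opprD addrCA subrr addr0.
have : D (s *: x + (1 - s) *: x0) -> r x0 - 1 < r (s *: x + (1 - s) *: x0).
  apply: er; rewrite -ball_normE/= zx0 normrN normrZ gtr0_norm//.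
  apply: le_lt_trans sq; rewrite ler_pM2l//; apply: (le_trans xrho).
  by rewrite (le_trans (ler_norm _))// lerDl ltW.
move=> /(_ (cD _ _ _ Dx Dx0 s01)) h1 h2.
rewrite -(ler_pM2l s0) mulrBr mulfV ?gt_eqF//; lra.
Qed.

Lemma bounded_additive_continuous (l : X -> R) C :
  (forall x y, l (x + y) = l x + l y) -> (forall a x, l (a *: x) = a * l x) ->
  (forall x, `|l x| <= C * `|x|) -> continuous l.
Proof.
move=> lD lZ lC x; apply/cvgrPdist_lt => e e0.
have C0 : 0 < `|C| + 1 by rewrite ltr_wpDl.
have eC : 0 < e / (`|C| + 1) by rewrite divr_gt0.
near=> y.
have -> : l x - l y = l (x - y) by rewrite lD -[- y]scaleN1r lZ mulN1r.
apply: (le_lt_trans (lC _)); apply: (@le_lt_trans _ _ ((`|C| + 1) * `|x - y|)).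
  by rewrite ler_wpM2r// (le_trans (ler_norm C))// lerDl.
rewrite -ltr_pdivlMl// mulrC.
by near: y; exact: (@cvgr_dist_lt _ _ _ _ _ id x cvg_id).
Unshelve. all: by end_near. Qed.

End RealConvexAnalysis.

(** * Approximate multiplier rule for a finite decoupled sum *)

Section FuzzyMultipliers.
Context {R : realType} {X : completeNormedModType R}.
Variables (n : nat) (D : nat -> set X) (r : nat -> X -> R) (xb : X).
Variables (rho delta eta c : R).
Hypothesis cD : forall t, (t < n.+1)%N -> cvx_set (D t).
Hypothesis cr : forall t, (t < n.+1)%N -> cvx_on (D t) (r t).
Hypothesis rlsc : forall t x, (t < n.+1)%N -> `|x - xb| <= rho ->
  lsc_on_at (D t) (r t) x.
Hypothesis Dxb : forall t, (t < n.+1)%N -> D t xb.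
Hypotheses (rho0 : 0 < rho) (delta0 : 0 < delta) (c0 : 0 < c).
Hypothesis eta_lt : eta < c * rho.

Let v := \sum_(t < n.+1) r t xb.

Hypothesis decoupled_min : forall x : nat -> X,
  (forall t, (t < n.+1)%N -> `|x t - xb| <= rho /\ D t (x t)) ->
  (forall s t, (s < n.+1)%N -> (t < n.+1)%N -> `|x s - x t| < delta) ->
  v - eta <= \sum_(t < n.+1) r t (x t).

Let A := [set x : nat -> X |
  forall t, (t < n.+1)%N -> `|x t - xb| <= rho /\ D t (x t)].

Lemma summand_lower_bounds : exists b : nat -> R,
  forall x t, A x -> (t < n.+1)%N -> b t <= r t (x t).
Proof.
have /choice[b bP] (t : nat) : exists b, (t < n.+1)%N ->
    forall x, D t x -> `|x - xb| <= rho -> b <= r t x.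
  have [tn|] := boolP (t < n.+1)%N; last by exists 0.
  have lr : lsc_on_at (D t) (r t) xb.
    by apply: rlsc => //; rewrite subrr normr0 ltW.
  have [b hb] := cvx_lsc_lower_bound rho (cr tn) (cD tn) (Dxb tn) lr.
  by exists b.
by exists b => x t Ax tn; have [xrho Dx] := Ax _ tn; exact: bP.
Qed.

Definition penalized (K : R) (x : nat -> X) : R :=
  \sum_(t < n.+1) r t (x t) + K * spread n x.

(** Entries within [delta / 2] of entry [0] are pairwise closer than [delta], and the decoupled
    bound applies. Otherwise the spread is at least [delta / 2], and [K] lets the penalty cover the
    gap between [v - eta] and the crude bound [B]. *)
Lemma penalized_lower_bound :
  exists2 K, 0 <= K & forall x, A x -> v - eta <= penalized K x.
Proof.
have [b bP] := summand_lower_bounds.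
pose B := \sum_(t < n.+1) b t.
have d20 : 0 < delta / 2 by rewrite divr_gt0.
exists (`|v - eta - B| / (delta / 2)); first by rewrite divr_ge0// ltW.
move=> x Ax; rewrite /penalized.
have spread0 := spread_ge0 n x.
have [close|/existsNP[t /not_implyP[tn /negP]]] :=
    pselect (forall t, (t < n.+1)%N -> `|x t - x 0%N| < delta / 2).
  rewrite -[leLHS]addr0; apply: lerD; last first.
    by rewrite mulr_ge0// divr_ge0// ltW.
  apply: decoupled_min => // s t sn tn.
  have := ler_distD (x 0%N) (x s) (x t).
  by have := close _ sn; have := close _ tn; rewrite (distrC (x t)); lra.
rewrite -leNgt => far.
have BS : B <= \sum_(t < n.+1) r t (x t) by apply: ler_sum => s _; exact: bP.
have dS : delta / 2 <= spread n x by apply: (le_trans far); exact: le_spread.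
have : `|v - eta - B| <= `|v - eta - B| / (delta / 2) * spread n x.
  by rewrite -mulrA -[leLHS]mulr1 ler_wpM2l// mulrC ler_pdivlMr// mul1r.
by have := ler_norm (v - eta - B); lra.
Qed.

(** Limits are taken entry by entry, with default [0] beyond [n]; letting [j] tend to infinity in
    the Cauchy estimate makes the convergence uniform over the entries. *)
Lemma cauchy_family_limit (u : nat -> nat -> X) :
  (forall e, 0 < e -> exists N, forall i j, (N <= i)%N -> (N <= j)%N ->
     maxnorm n (u i - u j) <= e) ->
  exists l : nat -> X,
    (forall t, (t < n.+1)%N -> u i t @[i --> \oo] --> l t) /\
    forall e, 0 < e -> exists N, forall i, (N <= i)%N -> maxnorm n (u i - l) <= e.
Proof.
move=> cu.
have /choice[l lP] (t : nat) : exists l : X, (t < n.+1)%N ->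
    u i t @[i --> \oo] --> l.
  have [tn|] := boolP (t < n.+1)%N; last by exists 0.
  suff /cauchy_cvgP ut : cauchy (u i t @[i --> \oo]).
    by exists (lim (u i t @[i --> \oo])).
  apply: cauchy_exP => e e0.
  have e20 : 0 < e / 2 by lra.
  have [N uN] := cu _ e20; exists (u N t).
  change (\forall i \near \oo, ball (u N t) e (u i t)).
  near=> i; rewrite -ball_normE/=.
  apply: (@le_lt_trans _ _ (e / 2)); last lra.
  apply: (le_trans (le_maxnorm (u N - u i) tn)); apply: uN => //.
  by near: i; exact: nbhs_infty_ge.
exists l; split=> // e e0.
have [N uN] := cu _ e0; exists N => i Ni.
apply: maxnorm_le => [|t tn]; first exact: ltW.
apply/ler_addgt0Pr => e' e'0; rewrite !fctE.
have /cvgrPdist_lt/(_ _ e'0) ul := lP _ tn.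
near \oo => j.
apply: (le_trans (ler_distD (u j t) _ _)); apply: lerD.
  apply: (le_trans (le_maxnorm (u i - u j) tn)); apply: uN => //.
  by near: j; exact: nbhs_infty_ge.
by rewrite distrC ltW//; near: j.
Unshelve. all: by end_near. Qed.

Lemma penalized_complete K (u : nat -> nat -> X) : 0 <= K ->
  (forall i, A (u i)) ->
  (forall e, 0 < e -> exists N, forall i j, (N <= i)%N -> (N <= j)%N ->
     maxnorm n (u i - u j) <= e) ->
  (forall i, penalized K (u i.+1) <= penalized K (u i)) ->
  exists l, [/\ A l,
    forall e, 0 < e -> exists N, forall i, (N <= i)%N -> maxnorm n (u i - l) <= e &
    forall i, penalized K l <= penalized K (u i)].
Proof.
move=> K0 Au /cauchy_family_limit[l [ul unif_ul]] u_dec.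
have u_decr i j : (i <= j)%N -> penalized K (u j) <= penalized K (u i).
  move=> /subnK<-; elim: (j - i)%N => [//|k IH]; rewrite addSn.
  exact: le_trans (u_dec _) IH.
have [b bP] := summand_lower_bounds.
have lrho t : (t < n.+1)%N -> `|l t - xb| <= rho.
  move=> tn; apply/ler_addgt0Pr => e e0.
  have /cvgrPdist_lt/(_ _ e0) ult := ul _ tn.
  near \oo => j.
  apply: (le_trans (ler_distD (u j t) _ _)); rewrite addrC; apply: lerD.
    exact: (Au j t tn).1.
  by rewrite ltW//; near: j.
have Dl t : (t < n.+1)%N -> D t (l t).
  move=> tn; apply: contrapT => nDl.
  (* The set [D t] may fail to be closed. Since penalized values decrease and the other summands are
     at least [b s], [a] bounds [r t] along the sequence; at a limit outside [D t], lower
     semicontinuity would force values above [a]. *)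
  pose a := penalized K (u 0%N) - \sum_(s < n.+1 | s != Ordinal tn) b s.
  have la := rlsc tn (lrho _ tn) (a := a) (fun Dl => False_ind _ (nDl Dl)).
  have [N _ hN] : \forall j \near \oo, D t (u j t) -> a < r t (u j t).
    exact: (ul _ tn _ la).
  have := hN N (leqnn _) (Au N t tn).2; apply/negP; rewrite -leNgt.
  have := u_decr 0%N N (leq0n _); rewrite /a /penalized.
  rewrite [X in X + _ <= _ -> _](bigD1 (Ordinal tn))//=.
  have : \sum_(s < n.+1 | s != Ordinal tn) b s <=
         \sum_(s < n.+1 | s != Ordinal tn) r s (u N s).
    by apply: ler_sum => s _; exact: bP.
  have := mulr_ge0 K0 (spread_ge0 n (u N)); lra.
have Al : A l by move=> t tn; split; [exact: lrho|exact: Dl].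
exists l; split=> // i; apply/ler_addgt0Pr => e e0.
(* [C] collects an error [e'] per summand and an error [2 e'] per term of the spread, weighted by
   [K], so that the total is [e]. *)
pose C := n.+1%:R + K * (n.+1%:R * 2) : R.
have n1 : 1 <= n.+1%:R :> R by rewrite ler1n.
have C0 : 0 < C.
  have : 0 <= K * (n.+1%:R * 2) by rewrite mulr_ge0//; lra.
  rewrite /C; lra.
pose e' := e / C; have e'0 : 0 < e' by rewrite divr_gt0.
have near_r (t : 'I_n.+1) : \forall j \near \oo, r t (l t) - e' < r t (u j t).
  have tn := ltn_ord t.
  have rt : r t (l t) - e' < r t (l t) by rewrite gtrDl oppr_lt0.
  have lj : \forall j \near \oo, D t (u j t) -> r t (l t) - e' < r t (u j t).
    exact: (ul _ tn _ (rlsc tn (lrho _ tn) (fun _ => rt))).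
  by apply: filterS lj => j; apply; exact: (Au j t tn).2.
have {}near_r := filter_forall _ near_r.
have [N uN] := unif_ul _ e'0.
near \oo => j.
have ij : (i <= j)%N by near: j; exact: nbhs_infty_ge.
apply: (le_trans _ (lerD (u_decr _ _ ij) (lexx e))).
have Nj : (N <= j)%N by near: j; exact: nbhs_infty_ge.
have rj : forall t : 'I_n.+1, r t (l t) - e' < r t (u j t).
  by near: j; exact: near_r.
have sum_le : \sum_(t < n.+1) r t (l t) <=
    \sum_(t < n.+1) r t (u j t) + n.+1%:R * e'.
  have -> : n.+1%:R * e' = \sum_(t < n.+1) e'.
    by rewrite sumr_const card_ord mulr_natl.
  rewrite -big_split/=.
  by apply: ler_sum => t _; have := rj t; lra.
have spread_le : spread n l <= spread n (u j) + n.+1%:R * (e' *+ 2).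
  have := spreadD n (u j) (l - u j); rewrite addrC subrK => /le_trans; apply.
  rewrite lerD2l; apply: (le_trans (spread_le_maxnorm _ _)).
  by rewrite ler_wpM2l// lerMn2r/= -maxnormN opprB; exact: uN.
have := ler_wpM2l K0 spread_le.
have eC : e = n.+1%:R * e' + K * (n.+1%:R * (e' *+ 2)).
  by rewrite -[LHS](divfK (lt0r_neq0 C0)) -/e' /C mulr2n; ring.
rewrite mulrDr /penalized; lra.
Unshelve. all: by end_near. Qed.


(** Ekeland's principle starts from the constant family [xb], whose penalized value is [v] because
    its spread is [0]. As the penalized sum is at least [v - eta], the displacement is at most
    [eta / c < rho], which leaves room inside the ball. *)
Lemma penalized_ekeland_point : exists K (xh : nat -> X),
  [/\ 0 <= K, A xh, maxnorm n (xh - (fun=> xb)) < rho,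
      \sum_(t < n.+1) r t (xh t) <= v &
      forall x, A x ->
        penalized K xh <= penalized K x + c * maxnorm n (x - xh)].
Proof.
have [K K0 Kmin] := penalized_lower_bound.
have dxx (x : nat -> X) : maxnorm n (x - x) = 0.
  by rewrite subrr -(scale0r 0) maxnormZ normr0 mul0r.
have dC (x y : nat -> X) : maxnorm n (x - y) = maxnorm n (y - x).
  by rewrite -opprB maxnormN.
have dtri (x y z : nat -> X) :
    maxnorm n (x - z) <= maxnorm n (x - y) + maxnorm n (y - z).
  by apply: le_trans (maxnormD _ _ _); rewrite addrA subrK.
have Axb : A (fun=> xb).
  by move=> t tn; rewrite subrr normr0 ltW//; split=> //; exact: Dxb.
have [xh [Axh xhle xhmin]] := ekeland dxx dC dtri c0 Kmin
  (fun u Au cu du => penalized_complete K0 Au cu du) Axb.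
have phixb : penalized K (fun=> xb) = v.
  by rewrite /penalized (@spread_cst _ _ _ xb)// mulr0 addr0.
rewrite phixb in xhle.
have dge0 := mulr_ge0 (ltW c0) (maxnorm_ge0 n ((fun=> xb) - xh)).
exists K, xh; split=> //.
- have := Kmin _ Axh; have := eta_lt; rewrite -maxnormN opprB => elt xhge.
  by rewrite -(ltr_pM2l c0); lra.
- by have := mulr_ge0 K0 (spread_ge0 n xh); move: xhle; rewrite /penalized; lra.
- by move=> x Ax; rewrite dC; exact: xhmin.
Qed.

(* Moving from the Ekeland point [xh] a small step along [w] stays in [A];
   convexity then turns local minimality into a global inequality. *)
Lemma penalized_directional_min : exists K (xh : nat -> X),
  [/\ 0 <= K, A xh, forall t, (t < n.+1)%N -> `|xh t - xb| < rho,
      \sum_(t < n.+1) r t (xh t) <= v &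
      forall w, (forall t, (t < n.+1)%N -> D t (xh t + w t)) ->
        0 <= \sum_(t < n.+1) (r t (xh t + w t) - r t (xh t)) +
             (K * spread n w + c * maxnorm n w)].
Proof.
have [K [xh [K0 Axh xhrho xhv xhmin]]] := penalized_ekeland_point.
exists K, xh; split=> // [t tn|w Dw].
  by apply: le_lt_trans xhrho; exact: (le_maxnorm (xh - (fun=> xb))).
pose M := maxnorm n w; have M0 : 0 <= M by exact: maxnorm_ge0.
pose q := rho - maxnorm n (xh - (fun=> xb)).
have q0 : 0 < q by rewrite subr_gt0.
have qM : 0 < 2 * q + M by lra.
(* The term [2 * q] keeps [s < 1] even when [M = 0], while [s * M <= q] keeps the moved family in
   the ball. *)
pose s := q / (2 * q + M).
have s0 : 0 < s by rewrite divr_gt0.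
have s1 : s < 1 by rewrite ltr_pdivrMr//; lra.
have sM : s * M <= q.
  rewrite /s mulrAC ler_pdivrMr// ler_pM2l//; lra.
have s01 : 0 < s < 1 by rewrite s0.
have step t : xh t + s *: w t = s *: (xh t + w t) + (1 - s) *: xh t.
  by rewrite scalerDr scalerBl scale1r addrAC [s *: xh t + _]addrC subrK.
have Aw : A (xh + s *: w).
  move=> t tn; rewrite !fctE; split; last first.
    by rewrite step; apply: (cD tn) => //; [exact: Dw|exact: (Axh t tn).2].
  rewrite addrAC; apply: (le_trans (ler_normD _ _)).
  have := le_maxnorm (xh - (fun=> xb)) tn; rewrite !fctE normrZ gtr0_norm//.
  have := ler_wpM2l (ltW s0) (le_maxnorm w tn); rewrite -/M; move: sM; rewrite /q.
  lra.
have := xhmin _ Aw.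
have -> : xh + s *: w - xh = s *: w by rewrite addrC addKr.
rewrite maxnormZ /penalized gtr0_norm//.
have := ler_wpM2l K0 (spreadD n xh (s *: w)); rewrite spreadZ gtr0_norm// mulrDr.
have sum_le : \sum_(t < n.+1) r t ((xh + s *: w) t) <= \sum_(t < n.+1) r t (xh t)
    + s * \sum_(t < n.+1) (r t (xh t + w t) - r t (xh t)).
  rewrite mulr_sumr -big_split/=; apply: ler_sum => t _.
  have tn := ltn_ord t; rewrite !fctE step.
  by have := cr tn (Dw _ tn) (Axh t tn).2 s01; lra.
by move=> ? ?; rewrite -(pmulr_rge0 _ s0); move: sum_le; lra.
Qed.

(** The sandwich gives one linear functional [N] on families, below [h] and dominated by [S]; its
    restriction to families supported at index [t] is the subgradient [L t]. *)
Theorem fuzzy_multipliers : exists (xh : nat -> X) (L : nat -> X -> R),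
  [/\ forall t, (t < n.+1)%N -> `|xh t - xb| < rho /\ D t (xh t),
      \sum_(t < n.+1) r t (xh t) <= v,
      forall t, dual_elt (L t),
      forall t y, (t < n.+1)%N -> D t y ->
        r t (xh t) + L t (y - xh t) <= r t y &
      forall y, `|\sum_(t < n.+1) L t y| <= c * `|y|].
Proof.
have [K [xh [K0 Axh xhrho xhv hS]]] := penalized_directional_min.
pose S (w : nat -> X) : R := K * spread n w + c * maxnorm n w.
pose h (w : nat -> X) := \sum_(t < n.+1) (r t (xh t + w t) - r t (xh t)).
pose Dh := [set w : nat -> X | forall t, (t < n.+1)%N -> D t (xh t + w t)].
have SD x y : S (x + y) <= S x + S y.
  have := ler_wpM2l K0 (spreadD n x y); have := ler_wpM2l (ltW c0) (maxnormD n x y).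
  by rewrite /S; lra.
have SZ a x : S (a *: x) = `|a| * S x by rewrite /S spreadZ maxnormZ; ring.
have Dh0 : Dh 0 by move=> t tn; rewrite [X in D t X]addr0; exact: (Axh t tn).2.
have h0 : h 0 = 0 by apply: big1 => t _; rewrite [xh t + _]addr0 subrr.
have hconv x y t : Dh x -> Dh y -> 0 < t < 1 -> Dh (t *: x + (1 - t) *: y) /\
    h (t *: x + (1 - t) *: y) <= t * h x + (1 - t) * h y.
  move=> Dx Dy t01.
  have comb s : xh s + (t *: x + (1 - t) *: y) s =
      t *: (xh s + x s) + (1 - t) *: (xh s + y s).
    by rewrite !fctE !scalerDr addrACA -scalerDl [t + _]addrC subrK scale1r.
  split=> [s sn|]; first by rewrite comb; apply: (cD sn); [exact: Dx|exact: Dy|].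
  rewrite /h !mulr_sumr -big_split/=; apply: ler_sum => s _; rewrite comb.
  by have := cr (ltn_ord s) (Dx _ (ltn_ord s)) (Dy _ (ltn_ord s)) t01; lra.
have [N [ND NZ NS Nh]] := seminorm_sandwich SD SZ Dh0 h0 hconv hS.
pose single t (y : X) : nat -> X := fun s => if s == t then y else 0.
have singleD t x y : single t (x + y) = single t x + single t y.
  by apply/funext => s; rewrite !fctE /single; case: ifP; rewrite ?addr0.
have singleZ t a y : single t (a *: y) = a *: single t y.
  by apply/funext => s; rewrite !fctE /single; case: ifP; rewrite ?scaler0.
(* This bound grows with [K] and [n], but it serves only the continuity of each [L t]. *)
have single_le t y : S (single t y) <= (K * (n.+1%:R * 2) + c) * `|y|.
  have le : maxnorm n (single t y) <= `|y|.
    by apply: maxnorm_le => // s _; rewrite /single; case: ifP; rewrite ?normr0.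
  have n0 : 0 <= K * n.+1%:R * 2 by rewrite !mulr_ge0.
  have := ler_wpM2l K0 (spread_le_maxnorm n (single t y)).
  rewrite mulr2n /S; have := ler_wpM2l n0 le; have := ler_wpM2l (ltW c0) le; lra.
exists xh, (fun t y => N (single t y)); split=> //.
- by move=> t tn; split; [exact: xhrho|exact: (Axh t tn).2].
- move=> t; split; [|split] => [x y|a x|]; rewrite ?singleD ?singleZ//.
  apply: (@bounded_additive_continuous _ _ _ (K * (n.+1%:R * 2) + c)).
  + by move=> x y; rewrite singleD.
  + by move=> a x; rewrite singleZ.
  + by move=> x; apply: le_trans (single_le t x).
- move=> t y tn Dy.
  have sE s : xh s + single t (y - xh t) s = if s == t then y else xh s.
    by rewrite /single; case: eqP => [->|_]; rewrite ?addr0// addrC subrK.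
  have Dsingle : Dh (single t (y - xh t)).
    by move=> s sn; rewrite sE; case: eqP => [->//|_]; exact: (Axh s sn).2.
  have := Nh _ Dsingle; rewrite /h (bigD1 (Ordinal tn))//= sE eqxx big1; first lra.
  move=> s; rewrite -val_eqE/= => /negPf st; by rewrite sE st subrr.
- move=> y.
  (* The [L t] add up to [N] on a family constant up to [n]; its spread vanishes, which leaves a
     bound with [c] alone. *)
  have sumN k :
      \sum_(t < k) N (single t y) = N (fun s => if (s < k)%N then y else 0).
    elim: k => [|k IH].
      have -> : (fun s => if (s < 0)%N then y else 0) = 0 *: (0 : nat -> X).
        by rewrite scale0r; apply/funext.
      by rewrite big_ord0 NZ mul0r.
    rewrite big_ord_recr/= IH -ND; congr N; apply/funext => s; rewrite !fctE /single.
    by rewrite [(s < k.+1)%N]ltnS; case: (ltngtP s k) => _; rewrite ?addr0 ?add0r.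
  rewrite sumN; apply: (le_trans (NS _)).
  rewrite /S (@spread_cst _ _ _ y) ?mulr0 ?add0r => [|t ->//].
  by rewrite ler_wpM2l ?(ltW c0)//; apply: maxnorm_le => // t ->.
Qed.

End FuzzyMultipliers.

(** * Extended-real-valued functions and duality *)

Section ExtendedReal.
Context {R : realType} {X : normedModType R}.
Implicit Types (f F : X -> \bar R) (v : \bar R) (l : R).

Lemma esmul_neq_ninfty l v : v != -oo%E -> esmul l v != -oo%E.
Proof. by case: v. Qed.

(** The convention for [0 * +oo] makes scaling preserve the effective domain even when the
    multiplier is zero. *)
Lemma esmul_lty l v : v != -oo%E -> (esmul l v < +oo)%E = (v < +oo)%E.
Proof. by case: v => // r; rewrite !ltry. Qed.

Lemma esmul_fin l v : v \is a fin_num -> esmul l v = (l * fine v)%:E.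
Proof. by case: v. Qed.

Lemma esmul_ge0 l v : 0 <= l -> (0 <= v)%E -> (0 <= esmul l v)%E.
Proof. by case: v => //= r l0; rewrite !lee_fin => r0; exact: mulr_ge0. Qed.

Lemma epos_ge0 f x : (0 <= epos f x)%E.
Proof. by rewrite /epos le_max lexx orbT. Qed.

Lemma epos_neq_ninfty f x : epos f x != -oo%E.
Proof. by rewrite gt_eqF// (lt_le_trans _ (epos_ge0 f x))// ltNyr. Qed.

Lemma edom_epos f : edom (epos f) = edom f.
Proof.
by apply/funext => x; apply/propext; rewrite /edom/= /epos gt_max ltry andbT.
Qed.

Lemma edom_fin f x : f x != -oo%E -> edom f x -> f x \is a fin_num.
Proof. by move=> fx dfx; rewrite fin_numE fx lt_eqF. Qed.

Lemma le_epos f x : (f x <= epos f x)%E.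
Proof. by rewrite /epos le_max lexx. Qed.

Lemma econvex_epos f : econvex f -> econvex (epos f).
Proof.
move=> cf x y t t01; have /andP[/ltW t0 /ltW t1] := t01.
have {}t0 : (0 <= t%:E)%E by rewrite lee_fin.
have {}t1 : (0 <= (1 - t)%:E)%E by rewrite lee_fin subr_ge0.
rewrite {1}/epos ge_max; apply/andP; split.
  apply: (le_trans (cf _ _ _ t01)).
  by apply: leeD; apply: lee_wpmul2l => //; exact: le_epos.
by apply: adde_ge0; apply: mule_ge0 => //; exact: epos_ge0.
Qed.

Lemma econvex_fine f : (forall x, f x != -oo%E) -> econvex f ->
  cvx_set (edom f) /\ cvx_on (edom f) (fine \o f).
Proof.
move=> fN cf.
suff H x y t : edom f x -> edom f y -> 0 < t < 1 ->
    edom f (t *: x + (1 - t) *: y) /\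
    fine (f (t *: x + (1 - t) *: y)) <= t * fine (f x) + (1 - t) * fine (f y).
  by split=> x y t dx dy t01; have [] := H _ _ _ dx dy t01.
move=> dx dy t01; have cxy := cf x y t t01.
rewrite -(fineK (edom_fin (fN x) dx)) -(fineK (edom_fin (fN y) dy)) in cxy.
rewrite -!EFinM -EFinD in cxy.
have dz : edom f (t *: x + (1 - t) *: y) by exact: le_lt_trans cxy (ltry _).
split=> //; rewrite -lee_fin fineK; last exact: edom_fin.
exact: cxy.
Qed.

Lemma lsc_on_at_fine f x : (forall y, f y != -oo%E) -> lsc_at f x ->
  lsc_on_at (edom f) (fine \o f) x.
Proof.
move=> fN lf a afx; have : (a%:E < f x)%E.
  have [dx|] := boolP (f x < +oo)%E; last first.
    by rewrite ltey negbK => /eqP->; exact: ltry.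
  by rewrite -(fineK (edom_fin (fN x) dx)) lte_fin; exact: afx.
move=> /lf; apply: filterS => y afy dy.
rewrite -lte_fin fineK; last exact: edom_fin.
exact: afy.
Qed.

Lemma subdiff_fine f x (L : X -> R) : (forall y, f y != -oo%E) -> dual_elt L ->
  edom f x -> (forall y, edom f y -> fine (f x) + L (y - x) <= fine (f y)) ->
  subdiff f x L.
Proof.
move=> fN dL dx fL; split=> //; split; first exact: edom_fin.
move=> y; have [dy|] := boolP (f y < +oo)%E; last first.
  by rewrite ltey negbK => /eqP->; exact: leey.
rewrite -(fineK (edom_fin (fN x) dx)) -(fineK (edom_fin (fN y) dy)).
by rewrite -EFinD lee_fin; exact: fL.
Qed.

(** For [l = 0] the scaled function is the indicator of [edom F], whose subgradients are normals;
    otherwise [L] is divided by [l]. *)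
Lemma msubdiff_fine l F x (L : X -> R) : 0 <= l -> (forall y, F y != -oo%E) ->
  dual_elt L -> edom F x ->
  (forall y, edom F y -> fine (esmul l (F x)) + L (y - x) <= fine (esmul l (F y))) ->
  msubdiff l F (edom F) x L.
Proof.
move=> l0 FN dL dx FL.
have {}FL y : edom F y -> l * fine (F x) + L (y - x) <= l * fine (F y).
  by move=> dy; have := FL _ dy; rewrite !esmul_fin// edom_fin.
rewrite /msubdiff; case: eqVneq => [l_eq0|l_neq0].
  split=> //; split=> // y dy; have := FL _ dy; rewrite l_eq0 !mul0r; lra.
have {}l0 : 0 < l by rewrite lt0r l_neq0.
exists (fun y => l^-1 * L y); split; last first.
  by apply/funext => y; rewrite mulrA mulfV// mul1r.
apply: subdiff_fine => // [|y dy].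
  case: dL => LD [LZ Lc]; split=> [x0 y|]; first by rewrite LD mulrDr.
  split=> [a y|y]; first by rewrite LZ mulrCA.
  by apply: cvgM; [exact: cvg_cst|exact: Lc].
by rewrite -(ler_pM2l l0) mulrDr mulrA mulfV// mul1r; exact: FL.
Qed.

End ExtendedReal.

(** * The collection and its upper sum *)

Section Collection.
Context {R : realType} {X : normedModType R}.
Variables (f : nat -> X -> \bar R) (m : nat) (lam : nat -> R).
Hypothesis fN : forall k x, f k x != -oo%E.
Hypothesis fconv : forall k, econvex (f k).
Hypothesis lam0 : forall k, (0 < k)%N -> 0 <= lam k.

Local Notation g := (coll m lam f).

Lemma coll0 : g 0%N = f 0%N.
Proof. by []. Qed.

Lemma coll_small k : (1 <= k <= m)%N -> g k = (fun x => esmul (lam k) (f k x)).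
Proof. by case: k => // k /andP[_ km]; rewrite /coll km. Qed.

Lemma coll_large k : (m < k)%N -> g k = (fun x => esmul (lam k) (epos (f k) x)).
Proof. by case: k => // k mk; rewrite /coll leqNgt mk. Qed.

Lemma coll_neq_ninfty k x : g k x != -oo%E.
Proof.
rewrite /coll; case: ifP => // _; case: ifP => _; apply: esmul_neq_ninfty => //.
exact: epos_neq_ninfty.
Qed.

Lemma coll_ge0 k x : (m < k)%N -> (0 <= g k x)%E.
Proof.
move=> mk; rewrite coll_large// esmul_ge0 ?epos_ge0//.
by apply: lam0; exact: leq_ltn_trans mk.
Qed.

Lemma edom_coll k : edom (g k) = edom (f k).
Proof.
apply/funext => x; rewrite /coll; case: ifP => [/eqP->//|_]; apply/propext.
case: ifP => _; rewrite /edom/= esmul_lty ?epos_neq_ninfty//.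
by rewrite -[X in _ <-> X]/(edom (f k) x) -edom_epos.
Qed.

Lemma cvx_on_coll k : cvx_on (edom (f k)) (fine \o g k).
Proof.
have ext (F : X -> \bar R) l : (forall x, F x != -oo%E) -> econvex F -> 0 <= l ->
    cvx_on (edom F) (fine \o (fun x => esmul l (F x))).
  move=> FN cF l0 x y t dx dy t01; have [cdF cfF] := econvex_fine FN cF.
  rewrite /= !esmul_fin ?edom_fin//; last exact: cdF.
  exact: (cvx_onZ l0 cfF).
rewrite /coll; case: k => [|k]; first exact: (econvex_fine (fN 0) (fconv 0)).2.
case: ifP => _; first by apply: ext; rewrite ?lam0.
rewrite -edom_epos; apply: (ext (epos (f k.+1))); last exact: lam0.
  exact: epos_neq_ninfty.
exact: econvex_epos.
Qed.

Lemma coll_sum n (x : nat -> X) : (m <= n)%N ->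
  (\sum_(t < n.+1) g t (x t) =
   f 0%N (x 0%N) + \sum_(1 <= k < m.+1) esmul (lam k) (f k (x k))
   + \sum_(m.+1 <= k < n.+1) esmul (lam k) (epos (f k) (x k)))%E.
Proof.
move=> mn; rewrite -(big_mkord xpredT (fun t => g t (x t))).
rewrite big_ltn// (@big_cat_nat _ _ _ m.+1)//= addeA coll0; congr (_ + _ + _)%E.
  by apply: eq_big_nat => k /andP[k1 km]; rewrite coll_small// k1.
by apply: eq_big_nat => k /andP[mk _]; rewrite coll_large.
Qed.

(** Every finite [S0] lies in an initial segment, so the supremum [s] dominates all late partial
    sums, and these converge to the Lagrangian because the tail is nonnegative. *)
Lemma lagr_le_upper_sum x : (lagr m lam f x <= upper_sum g x)%E.
Proof.
apply/ereal_infP => _ [S0 fS0 <-]; set s := ereal_sup _.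
have [N S0N] : exists N, S0 `<=` `I_N.
  have [S SE] := (finite_seqP _).1 fS0.
  exists (\max_(k <- S) k).+1 => k; rewrite SE /= ltnS => kS.
  exact: (leq_bigmax_seq (F := id) k kS).
set h := (f 0%N x + \sum_(1 <= k < m.+1) esmul (lam k) (f k x))%E.
have hs n : (maxn m N <= n)%N ->
    (h + \sum_(m.+1 <= k < n.+1) esmul (lam k) (epos (f k) x) <= s)%E.
  rewrite geq_max => /andP[mn Nn].
  rewrite -(coll_sum (fun=> x) mn); apply: ereal_sup_ubound.
  exists `I_n.+1; last by rewrite -fsbig_ord.
  split; first exact: finite_II.
  by move=> k /S0N/= kN; rewrite ltnS ltnW// (leq_trans kN).
have tail0 k : (m < k)%N -> (0 <= esmul (lam k) (epos (f k) x))%E.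
  by move=> mk; have := coll_ge0 x mk; rewrite coll_large.
have hN : h != -oo%E.
  rewrite /h adde_eq_ninfty negb_or fN/=; apply/negP => /eqP.
  rewrite esum_eqNyP => -[k [_ _ /eqP]]; apply/negP.
  by rewrite esmul_neq_ninfty.
rewrite /lagr -/h; have [hfin|] := boolP (h \is a fin_num).
  rewrite -leeBrDl//; apply: lime_le.
    by apply: is_cvg_nneseries => k mk _; exact: tail0.
  near=> n; rewrite leeBrDl//.
  have nM : (maxn m N < n)%N by near: n; exact: nbhs_infty_gt.
  have nE : n.-1.+1 = n by rewrite prednK// (leq_trans _ nM).
  by rewrite -nE; apply: hs; rewrite -ltnS nE.
(* If [h] is [+oo] it cannot be subtracted, but a single partial sum already forces [s] to be
   [+oo]. *)
rewrite fin_numE hN/= negbK => /eqP h_eq.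
have := hs _ (leqnn _); rewrite h_eq addye ?leye_eq => [/eqP->|]; first exact: leey.
rewrite gt_eqF// (@lt_le_trans _ _ 0%E)// ?ltNyr// big_nat_cond.
by apply: sume_ge0 => k /andP[/andP[mk _] _]; exact: tail0.
Unshelve. all: by end_near. Qed.

End Collection.

(** * Strong duality under the Slater condition *)

Section StrongDuality.
Context {R : realType} {X : normedModType R}.
Variables (f : nat -> X -> \bar R) (m : nat).
Hypothesis fN : forall k x, f k x != -oo%E.
Hypothesis fconv : forall k, econvex (f k).

Let G x := ereal_sup [set f k x | k in [set k | (m < k)%N]].

Let f_le_G k x : (m < k)%N -> (f k x <= G x)%E.
Proof. by move=> mk; apply: ereal_sup_ubound; exists k. Qed.

Let G_neq_ninfty x : G x != -oo%E.
Proof.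
rewrite gt_eqF// (lt_le_trans _ (f_le_G x (ltnSn m)))//.
by rewrite ltNye fN.
Qed.

Let G_econvex : econvex G.
Proof.
move=> x y t t01; have /andP[/ltW t0 /ltW t1] := t01.
apply: ge_ereal_sup => _ [k mk <-]; apply: (le_trans (fconv k x y t01)).
by apply: leeD; apply: lee_wpmul2l; rewrite ?lee_fin ?subr_ge0//; exact: f_le_G.
Qed.

(** On this convex set the objective and all constraints are finite, so the real-valued multiplier
    theorem applies. *)
Let A := [set x | [/\ edom (f 0%N) x,
  forall k, (k < m)%N -> edom (f k.+1) x & edom G x]].

(** Indices are shifted by one: [i < m] stands for [f i.+1], and [i = m] for the merged constraint
    [G]. *)
Let constraint i x := if (i < m)%N then fine (f i.+1 x) else fine (G x).

Let A_edom k x : A x -> edom (f k) x.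
Proof.
move=> [f0 fm Gx]; case: k => // k; have [/fm//|mk] := ltnP k m.
by apply: le_lt_trans (f_le_G x _) Gx; rewrite ltnS.
Qed.

Let A_cvx : cvx_set A.
Proof.
move=> x y t [f0x fmx Gx] [f0y fmy Gy] t01; split.
- exact: (econvex_fine (fN 0) (fconv 0)).1.
- move=> k km; apply: (econvex_fine (fN k.+1) (fconv k.+1)).1 => //;
    [exact: fmx|exact: fmy].
- exact: (econvex_fine G_neq_ninfty G_econvex).1.
Qed.

Let constraint_cvx i : cvx_on A (constraint i).
Proof.
have [im|/negPf im] := boolP (i < m)%N.
  have -> : constraint i = fine \o f i.+1.
    by apply/funext => x; rewrite /constraint im.
  apply: (@cvx_onW _ _ (edom (f i.+1))) => [x|]; first exact: A_edom.
  exact: (econvex_fine (fN i.+1) (fconv i.+1)).2.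
have -> : constraint i = fine \o G.
  by apply/funext => x; rewrite /constraint im.
apply: (@cvx_onW _ _ (edom G)) => [x []//|].
exact: (econvex_fine G_neq_ninfty G_econvex).2.
Qed.

(* The constraints with index [> m] are first merged into the single one
   [sup_(k > m) f k <= 0], whose multiplier [r] is then dominated by giving
   each [max (f k) 0] the weight [r + 1]. *)
Lemma strong_duality (v : R) :
  (exists x, edom (f 0%N) x /\
     (ereal_sup [set f k x | k in [set k | (0 < k)%N]] < 0)%E) ->
  (forall x, pfeasible f x -> (v%:E <= f 0%N x)%E) ->
  exists2 mu, linf_pos mu & forall x, (v%:E <= lagr m mu f x)%E.
Proof.
move=> [x0 [f0x0 slater]] vmin.
have fx0 k : (0 < k)%N -> (f k x0 < 0)%E.
  by move=> k0; apply: le_lt_trans slater; apply: ereal_sup_ubound; exists k.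
have Gx0 : (G x0 < 0)%E.
  apply: le_lt_trans slater; apply: ereal_sup_le => _ [k /= mk <-].
  by exists k => //=; exact: leq_ltn_trans mk.
have Ax0 : A x0.
  split=> // [k km|]; first exact: lt_trans (fx0 _ _) (ltry 0).
  exact: lt_trans Gx0 (ltry 0).
have finA k x : A x -> f k x \is a fin_num.
  by move=> Ax; apply: edom_fin => //; exact: A_edom.
have finG x : A x -> G x \is a fin_num.
  by move=> [_ _ Gx]; exact: edom_fin.
have [|i im1|x Ax gx|nu nu0 hnu] := @lagrange_multipliers _ _ m.+1 A
    (fine \o f 0%N) constraint x0 v A_cvx _ (fun i _ => constraint_cvx i) Ax0.
- apply: (@cvx_onW _ _ (edom (f 0%N))) => [x|]; first exact: A_edom.
  exact: (econvex_fine (fN 0) (fconv 0)).2.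
- rewrite /constraint; case: ifP => im; rewrite -lte_fin fineK ?finA ?finG//.
  exact: fx0.
- rewrite -lee_fin fineK ?finA//; apply: vmin => k; case: k => // k _.
  have [km|mk] := ltnP k m.
    by have := gx k (ltnW km); rewrite /constraint km -lee_fin fineK ?finA.
  apply: le_trans (f_le_G x _) _; first by rewrite ltnS.
  by have := gx m (ltnSn m); rewrite /constraint ltnn -lee_fin fineK ?finG.
pose r := nu m.
pose mu k := if (k <= m)%N then nu k.-1 else r + 1.
have mu0 k : 0 <= mu k by rewrite /mu; case: ifP => _ //; rewrite addr_ge0 ?nu0.
have mu_large k : (m < k)%N -> mu k = r + 1 by rewrite /mu ltnNge => /negPf->.
exists mu; first split=> //.
  exists (\sum_(i < m.+1) nu i + 1) => k k0; rewrite /mu; case: ifP => [km|_].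
    rewrite -[leLHS]addr0 lerD//.
    have km' : (k.-1 < m.+1)%N by rewrite prednK// ltnW.
    by rewrite (bigD1 (Ordinal km'))//= lerDl sumr_ge0.
  by rewrite lerD2r /r big_ord_recr/= lerDr sumr_ge0.
move=> x; have [Lx|] := boolP (lagr m mu f x < +oo)%E; last first.
  by rewrite ltey negbK => /eqP->; exact: leey.
have tail0 k : (m < k)%N -> (0 <= esmul (mu k) (epos (f k) x))%E.
  by move=> mk; apply: esmul_ge0 => //; exact: epos_ge0.
have headE : (\sum_(1 <= k < m.+1) esmul (mu k) (f k x) =
    \sum_(i < m) esmul (nu i) (f i.+1 x))%E.
  rewrite big_add1 big_mkord; apply: eq_bigr => i _.
  by rewrite /mu ltn_ord.
move: Lx; rewrite /lagr headE; set h := (\sum_(i < m) _)%E.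
set tl := (\sum_(_ <= _ <oo) _)%E.
have tl0 : (0 <= tl)%E by apply: nneseries_ge0 => k mk _; exact: tail0.
have hN : h != -oo%E.
  apply/negP; rewrite esum_eqNy => /existsP[i /andP[_ /eqP]]; apply/eqP.
  by rewrite esmul_neq_ninfty.
move=> Lx.
have [f0x hy tly] : [/\ edom (f 0%N) x, h != +oo%E & tl != +oo%E].
  move: Lx (fN 0 x) hN tl0; rewrite /edom/=.
  by case: (f 0%N x) => [a||]//; case: h => [b||]//; case: tl => // *; rewrite ltry.
(* Finiteness of [h] reaches every [f k.+1 x], including those with zero multiplier, thanks to the
   convention in [esmul]. *)
have fmx k : (k < m)%N -> edom (f k.+1) x.
  move=> km; rewrite /edom/= -(esmul_lty (nu k))// ltey; apply/negP => /eqP fy.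
  move/negP: hy; apply.
  rewrite esum_eqy; last by move=> i _; exact: esmul_neq_ninfty.
  by apply/existsP; exists (Ordinal km); rewrite fy/=.
pose s := fine tl.
have tlE : tl = s%:E.
  by rewrite fineK// fin_numE tly gt_eqF// (lt_le_trans _ tl0)// ltNyr.
have s0 : 0 <= s by rewrite -lee_fin -tlE.
have r0 : 0 <= r by exact: nu0.
have r1 : 0 < r + 1 by lra.
(* One term of the tail is at most the whole tail. The weight [r + 1] is positive even when [r = 0],
   so division gives a bound uniform in [k], hence [G x] is finite. *)
have fks k : (m < k)%N -> (f k x <= (s / (r + 1))%:E)%E.
  move=> mk; apply: (le_trans (le_epos (f k) x)).
  have : (esmul (mu k) (epos (f k) x) <= s%:E)%E.
    rewrite -tlE; apply: le_trans (nneseries_lim_ge k.+1 _); last first.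
      by move=> i mi _; exact: tail0.
    rewrite big_nat_recr//= leeDr// big_nat_cond.
    by apply: sume_ge0 => i /andP[/andP[mi _] _]; exact: tail0.
  rewrite mu_large//; case: (epos (f k) x) (epos_ge0 (f k) x) => //= a _.
  by rewrite -EFinM !lee_fin ler_pdivlMr// mulrC.
have Gs : (G x <= (s / (r + 1))%:E)%E.
  by apply: ge_ereal_sup => _ [k mk <-]; exact: fks.
have Ax : A x by split=> //; exact: le_lt_trans Gs (ltry _).
have := hnu _ Ax; rewrite big_ord_recr/= /constraint ltnn -/r.
have -> : h = (\sum_(i < m) nu i * constraint i x)%:E.
  rewrite -sumEFin; apply: eq_bigr => i _.
  by rewrite /constraint ltn_ord esmul_fin// finA.
rewrite tlE -(fineK (finA 0 x Ax)) -!EFinD lee_fin => /le_trans; apply.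
under eq_bigr => i _ do rewrite /constraint ltn_ord.
rewrite addrA lerD2l.
have {}Gs : fine (G x) <= s / (r + 1) by rewrite -lee_fin fineK ?finG.
apply: (le_trans (ler_wpM2l r0 Gs)).
by rewrite mulrCA ler_piMr// ler_pdivrMr// mul1r; lra.
Qed.

End StrongDuality.

(** Some finite [S0] has all its finite supersets above [v - eta] in the definition of [Lambda]; the
    superset chosen is an initial segment reaching beyond [M]. *)
Lemma ulsc_decoupled_lower_bound (R : realType) (X : normedModType R)
    (g : nat -> X -> \bar R) (U : set X) (v eta : R) (M : nat) :
  (forall x, (v%:E <= upper_sum g x)%E) -> ulsc g U -> 0 < eta ->
  exists2 n, (M < n)%N & exists2 d : R, 0 < d & forall xs : nat -> X,
    (forall t, (t < n.+1)%N -> U (xs t)) ->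
    (forall s t, (s < n.+1)%N -> (t < n.+1)%N -> `|xs s - xs t| < d) ->
    ((v - eta)%:E <= \sum_(t < n.+1) g t (xs t))%E.
Proof.
move=> vg ulscg eta0.
have : ((v - eta)%:E < Lambda g U)%E.
  apply: lt_le_trans ulscg; apply: (@lt_le_trans _ _ v%:E).
    by rewrite lte_fin gtrDl oppr_lt0.
  by apply/ereal_infP => _ [x _ <-].
move=> /ereal_sup_gt[_ [S0 fS0 <-] lt_inf].
have [s sE] := (finite_seqP _).1 fS0.
pose n := (maxn M (\max_(k <- s) k)).+1.
exists n; first by rewrite ltnS leq_maxl.
have S0n : supsets S0 `I_n.+1.
  split; first exact: finite_II.
  move=> k; rewrite sE /= => ks; rewrite ltnS ltnW// ltnS leq_max.
  by rewrite (leq_bigmax_seq (F := id) k ks)// orbT.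
have := lt_le_trans lt_inf (ereal_inf_lbound (ex_intro2 _ _ _ S0n erefl)).
move=> /ereal_sup_gt[_ [d /= d0 <-] lt_d].
exists d => // xs Uxs dxs; apply/ltW/(lt_le_trans lt_d).
apply: ereal_inf_lbound; exists xs => //.
by rewrite -fsbig_ord.
Qed.

Lemma nbhs_closed_ball (R : realType) (X : normedModType R) (x : X) (U : set X) :
  nbhs x U ->
  exists2 e : R, 0 < e & forall y, `|y - x| <= e -> U y.
Proof.
move=> /nbhs_ballP[e /= e0 eU]; exists (e / 2); first by rewrite divr_gt0.
move=> y ye; apply: eU; rewrite -ball_normE/= distrC; lra.
Qed.

(** * The collection at the solution *)

Section AtSolution.
Context {R : realType} {X : normedModType R}.
Variables (f : nat -> X -> \bar R) (xb : X) (m : nat) (lam : nat -> R).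
Hypothesis fN : forall k x, f k x != -oo%E.
Hypothesis lam0 : forall k, (0 < k)%N -> 0 <= lam k.
Hypothesis xb_feasible : pfeasible f xb.
Hypothesis xb_dom : edom (f 0%N) xb.
Hypothesis xb_le_lagr : (f 0%N xb <= lagr m lam f xb)%E.

Let xb_fin k : f k xb \is a fin_num.
Proof.
apply: edom_fin => //; case: k => // k.
exact: le_lt_trans (xb_feasible (ltn0Sn k)) (ltry 0).
Qed.

Let large_eq0 k : (m < k)%N -> esmul (lam k) (epos (f k) xb) = 0%E.
Proof.
move=> mk; have -> : epos (f k) xb = 0%E.
  by apply/max_idPr; apply: xb_feasible; exact: leq_ltn_trans mk.
by rewrite esmul_fin// mulr0.
Qed.

(** At [xb] the terms beyond [m] vanish and the others are nonpositive, while their sum is at least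
    [0]; so each of them is [0]. *)
Lemma complementary_slackness k : (1 <= k <= m)%N ->
  esmul (lam k) (f k xb) = 0%E.
Proof.
move: xb_le_lagr; rewrite /lagr (eseries0 (fun i mi _ => large_eq0 mi)) adde0.
have -> : (\sum_(1 <= k < m.+1) esmul (lam k) (f k xb) =
    (\sum_(i < m) lam i.+1 * fine (f i.+1 xb))%:E)%E.
  rewrite big_add1 big_mkord -sumEFin; apply: eq_bigr => i _.
  by rewrite esmul_fin.
rewrite -(fineK (xb_fin 0)) -EFinD lee_fin lerDl => sum0.
case: k => // k /andP[_ km]; rewrite esmul_fin//; congr EFin.
have le0 i : lam i.+1 * fine (f i.+1 xb) <= 0.
  by rewrite mulr_ge0_le0 ?lam0// -lee_fin fineK//; exact: xb_feasible.
apply/eqP; rewrite eq_le le0/= (le_trans sum0)//.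
rewrite (bigD1 (Ordinal km))//= gerDl.
by rewrite -oppr_ge0 -sumrN; apply: sumr_ge0 => i _; rewrite oppr_ge0.
Qed.

Lemma coll_at_solution k : (0 < k)%N -> coll m lam f k xb = 0%E.
Proof.
move=> k0; have [km|mk] := leqP k m; last by rewrite coll_large// large_eq0.
by rewrite coll_small ?k0// complementary_slackness ?k0.
Qed.

End AtSolution.

Theorem theorem4p3 (R : realType) (X : completeNormedModType R)
  (f : nat -> X -> \bar R) (xbar : X) (m : nat) (lam : nat -> R) :
  (forall k, eproper (f k)) ->
  (forall k, econvex (f k)) ->
  (exists x, edom (f 0%N) x /\ pfeasible f x) ->
  sol_P f xbar ->
  (exists x, edom (f 0%N) x /\
     (ereal_sup [set f k x | k in [set k | (0 < k)%N]] < 0)%E) ->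
  sol_D m f lam ->
  (exists U, nbhs xbar U /\ forall t x, U x -> lsc_at (coll m lam f t) x) ->
  (exists U, nbhs xbar U /\ ulsc (coll m lam f) U) ->
  (forall k, (1 <= k <= m)%N -> esmul (lam k) (f k xbar) = 0%E) /\
  (forall (eps : R) (M : nat), 0 < eps -> (m < M)%N ->
   exists (n : nat) (x : nat -> X),
     (M < n)%N /\
     (forall k, (k <= n)%N -> ball xbar eps (x k)) /\
     (f 0%N (x 0%N) + \sum_(1 <= k < m.+1) esmul (lam k) (f k (x k))
        + \sum_(m.+1 <= k < n.+1) esmul (lam k) (epos (f k) (x k))
        <= f 0%N xbar)%E /\
     exists xs : nat -> X -> R,
       subdiff (f 0%N) (x 0%N) (xs 0%N) /\
       (forall k, (1 <= k <= m)%N ->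
          msubdiff (lam k) (f k) (edom (f k)) (x k) (xs k)) /\
       (forall k, (m < k <= n)%N ->
          msubdiff (lam k) (epos (f k)) (edom (f k)) (x k) (xs k)) /\
       dual_small eps (fun y => \sum_(0 <= k < n.+1) xs k y)).
Proof.
move=> fproper fconv [x1 [f0x1 x1_feas]] [xb_feas xb_min] slater [[lam0 _] lam_opt].
move=> [U1 [/nbhs_closed_ball[e1 e10 eU1] lscU]].
move=> [U2 [/nbhs_closed_ball[e2 e20 eU2] ulscU]].
have fN k x : f k x != -oo%E by exact: (fproper k).1.
have xb_dom : edom (f 0%N) xbar by exact: le_lt_trans (xb_min _ x1_feas) f0x1.
have f0fin : f 0%N xbar \is a fin_num by exact: edom_fin.
have [v vE] : exists v : R, f 0%N xbar = v%:E.
  by exists (fine (f 0%N xbar)); rewrite fineK.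
have lagr_ge x : (v%:E <= lagr m lam f x)%E.
  have xb_min' y : pfeasible f y -> (v%:E <= f 0%N y)%E.
    by rewrite -vE; exact: xb_min.
  (* [mu] shows that the dual value is at least [v]; as [lam] attains the supremum, its own
     Lagrangian inherits the bound. *)
  have [mu mu_pos mu_le] := strong_duality m fN fconv slater xb_min'.
  apply: (@le_trans _ _ (dval m f mu)); first by apply/ereal_infP => _ [y _ <-].
  apply: (@le_trans _ _ (dval m f lam)); last by apply: ereal_inf_lbound; exists x.
  by rewrite lam_opt; apply: ereal_sup_ubound; exists mu.
have xb_lagr : (f 0%N xbar <= lagr m lam f xbar)%E by rewrite vE.
split; first exact: complementary_slackness.
move=> eps M eps0 mM.
have v_le x : (v%:E <= upper_sum (coll m lam f) x)%E.
  apply: (le_trans (lagr_ge x)); exact: lagr_le_upper_sum.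
(* The closed ball of radius [rho] fits into both neighbourhoods and into the open ball of radius
   [eps]. *)
pose rho := Num.min (Num.min e1 e2) (eps / 2).
have rho0 : 0 < rho by rewrite !lt_min e10 e20 divr_gt0.
have rho_e1 : rho <= e1 by rewrite !ge_min lexx.
have rho_e2 : rho <= e2 by rewrite !ge_min lexx orbT.
have rho_eps : rho < eps by rewrite gt_min; apply/orP; right; lra.
(* The slope [c] bounds the dual norm of the sum, which must be strictly below [eps]; [eta] is then
   half of the admissible threshold [c * rho]. *)
pose c := eps / 2; have c0 : 0 < c by rewrite divr_gt0.
pose eta := c * rho / 2; have eta0 : 0 < eta by rewrite divr_gt0// mulr_gt0.
have eta_lt : eta < c * rho by rewrite /eta; have := mulr_gt0 c0 rho0; lra.
have [n Mn [d d0 g_ge]] := ulsc_decoupled_lower_bound M v_le ulscU eta0.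
have mn : (m <= n)%N by rewrite ltnW// (ltn_trans mM).
pose g := coll m lam f.
have gN t x : g t x != -oo%E by exact: coll_neq_ninfty.
have gfin t x : edom (f t) x -> g t x \is a fin_num.
  by move=> dx; apply: edom_fin => //; rewrite edom_coll.
have dom_xb t : edom (f t) xbar.
  by case: t => // t; exact: le_lt_trans (xb_feas _ (ltn0Sn t)) (ltry 0).
(* At [xbar] every member of the collection except [f 0] vanishes, by complementary slackness or
   feasibility. *)
have gxb : \sum_(t < n.+1) fine (g t xbar) = v.
  rewrite big_ord_recl big1 ?addr0 => [|t _]; first by rewrite /g coll0 vE.
  by rewrite /g coll_at_solution.
have glsc t x : (t < n.+1)%N -> `|x - xbar| <= rho ->
    lsc_on_at (edom (f t)) (fine \o g t) x.
  move=> _ xrho; rewrite -(edom_coll m lam fN t); apply: lsc_on_at_fine => //.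
  by apply: lscU; apply: eU1; exact: le_trans rho_e1.
have [|xh [L [xhP xh_le Ldual Lsub Lsmall]]] := @fuzzy_multipliers _ _ n
    (fun t => edom (f t)) (fun t => fine \o g t) xbar rho d eta c
    (fun t _ => (econvex_fine (fN t) (fconv t)).1)
    (fun t _ => @cvx_on_coll _ _ f m lam fN fconv lam0 t) glsc (fun t _ => dom_xb t)
    rho0 d0 c0 eta_lt.
  move=> x xP xd; rewrite gxb -lee_fin -sumEFin.
  apply: le_trans (g_ge x _ xd) _; first last.
    rewrite le_eqVlt; apply/orP; left; apply/eqP; apply: eq_bigr => t _.
    by rewrite /= fineK// gfin//; exact: (xP t (ltn_ord t)).2.
  by move=> t tn; apply: eU2; exact: le_trans (xP t tn).1 rho_e2.
rewrite gxb in xh_le.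
have Lsub_at t : (t <= n)%N -> forall y, edom (f t) y ->
    fine (g t (xh t)) + L t (y - xh t) <= fine (g t y).
  by move=> tn y dy; exact: Lsub.
exists n, xh; split=> //; split; [|split].
- move=> k kn; rewrite -ball_normE/= distrC.
  exact: lt_trans (xhP k kn).1 rho_eps.
- rewrite -coll_sum// vE.
  apply: (@le_trans _ _ (\sum_(t < n.+1) fine (g t (xh t)))%:E) => //.
  rewrite -sumEFin; apply: lee_sum => t _.
  by rewrite fineK// gfin//; exact: (xhP t (ltn_ord t)).2.
- exists L; split; [|split; [|split]].
  + by apply: subdiff_fine => //; [exact: (xhP 0%N isT).2|exact: Lsub_at].
  + move=> k /[dup] k1m /andP[k1 km]; have kn : (k <= n)%N by exact: leq_trans mn.
    apply: msubdiff_fine => //; [exact: lam0|exact: (xhP k kn).2|move=> y dy].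
    by have := Lsub_at k kn y dy; rewrite /g coll_small.
  + move=> k /andP[mk kn]; rewrite -edom_epos.
    apply: msubdiff_fine => //; [by apply: lam0; exact: leq_ltn_trans mk
      |exact: epos_neq_ninfty|by rewrite edom_epos; exact: (xhP k kn).2|move=> y].
    by rewrite edom_epos => dy; have := Lsub_at k kn y dy; rewrite /g coll_large.
  + exists c; split; first by rewrite /c; lra.
    by move=> y; rewrite big_mkord; exact: Lsmall.
Qed.
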